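(* Let $A$ be an $n\times N$ matrix whose entries are drawn i.i.d. from $\mathcal{N}(0,1/n)$. In the limit as $n\to\infty$ with $n/N\to\delta\in(0,1)$, a sufficient condition for recovery by Orthogonal Matching Pursuit (OMP) with $k$ steps is $$n>2k(k-1)\left[3+2\log N+\log n-3\log k\right].$$ That is, along any sequence of triples $(k,n,N)$ with $n\to\infty$, $n/N\to\delta\in(0,1)$ and satisfying this inequality, with probability tending to $1$ the matrix $A$ is such that OMP run for $k$ steps on input $(A,y)$ with $y=Ax_0$ returns $x_0$, for every vector $x_0\in\mathbb{R}^N$ with at most $k$ nonzero entries.
   Context: Triples $(k,n,N)$ consist of positive integers with $k\le n\le N$; $\log$ is the natural logarithm. Orthogonal Matching Pursuit with $k$ steps: given $A\in\mathbb{R}^{n\times N}$ with columns $a_1,\dots,a_N$ and $y\in\mathbb{R}^n$, set $r^0=y$ and $T^0=\emptyset$. For $j=1,\dots,k$: choose an index $i_j\in\arg\max_{1\le i\le N}|\langle a_i,r^{j-1}\rangle|$, set $T^j=T^{j-1}\cup\{i_j\}$, let $x^j$ minimise $\|y-Az\|_2$ over all $z\in\mathbb{R}^N$ supported on $T^j$, and set $r^j=y-Ax^j$. The output is $x^k$. *)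

(* Defs.v *)
From HB Require Import structures.
From mathcomp Require Export all_boot all_order all_algebra.
From mathcomp Require Export all_classical all_reals all_analysis.
Export Order.TTheory GRing.Theory Num.Theory.
Export numFieldNormedType.Exports.

Set Implicit Arguments.
Unset Strict Implicit.
Unset Printing Implicit Defensive.

Local Open Scope classical_set_scope.
Local Open Scope ring_scope.

Definition dotp (R : realType) (n : nat) (u v : 'cV[R]_n) : R :=
  \sum_(i < n) u i 0 * v i 0.

(* The canonical norm `|u| on matrices is the sup norm, hence this one. *)
Definition l2norm (R : realType) (n : nat) (u : 'cV[R]_n) : R :=
  Num.sqrt (\sum_(i < n) u i 0 ^+ 2).

Definition vsupp (R : realType) (N : nat) (z : 'cV[R]_N) : {set 'I_N} :=
  [set i | z i 0 != 0]%SET.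

Definition is_argmax_correlation (R : realType) (n N : nat) (A : 'M[R]_(n, N))
    (r : 'cV[R]_n) (i : 'I_N) : Prop :=
  forall i' : 'I_N, `|dotp (col i' A) r| <= `|dotp (col i A) r|.

Definition is_least_squares (R : realType) (n N : nat) (A : 'M[R]_(n, N))
    (y : 'cV[R]_n) (T : {set 'I_N}) (x : 'cV[R]_N) : Prop :=
  vsupp x \subset T /\
  forall z : 'cV[R]_N, vsupp z \subset T ->
    l2norm (y - A *m x) <= l2norm (y - A *m z).

(* The entries i 0 and x 0 play no role: the first index chosen is i 1. *)
Definition omp_run (R : realType) (n N : nat) (A : 'M[R]_(n, N))
    (y : 'cV[R]_n) (k : nat) (i : nat -> 'I_N) (T : nat -> {set 'I_N})
    (x : nat -> 'cV[R]_N) (r : nat -> 'cV[R]_n) : Prop :=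
  [/\ r 0%N = y, T 0%N = finset.set0 &
    forall j : nat, (1 <= j <= k)%N ->
      [/\ is_argmax_correlation A (r j.-1) (i j),
          T j = (T j.-1 :|: [set i j])%SET,
          is_least_squares A y (T j) (x j) &
          r j = y - A *m x j]].

(* Neither the choice of the index nor the least-squares minimiser need be
   unique, so the algorithm has a set of possible outputs. *)
Definition omp_output (R : realType) (n N : nat) (A : 'M[R]_(n, N))
    (y : 'cV[R]_n) (k : nat) : set 'cV[R]_N :=
  [set z | exists (i : nat -> 'I_N) (T : nat -> {set 'I_N})
             (x : nat -> 'cV[R]_N) (r : nat -> 'cV[R]_n),
             omp_run A y k i T x r /\ x k = z].

(* "OMP returns x0" means that x0 is an output, and the only one, whatever
   choices are made. *)
Definition omp_recovers (R : realType) (n N : nat) (k : nat)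
    (A : 'M[R]_(n, N)) : Prop :=
  forall x0 : 'cV[R]_N, (#|vsupp x0| <= k)%N ->
    omp_output A (A *m x0) k = [set x0].

Definition mutually_independent d (Omega : measurableType d) (R : realType)
    (P : probability Omega R) (I : finType) (X : I -> {RV P >-> R}) : Prop :=
  forall (J : {set I}) (B : I -> set R), (forall i, measurable (B i)) ->
    P (\bigcap_(i in [set` J]) (X i @^-1` B i)) =
    (\prod_(i in J) P (X i @^-1` B i))%E.

(* The second parameter of normal_prob is the standard deviation. *)
Definition iid_gaussian_entries d (Omega : measurableType d) (R : realType)
    (P : probability Omega R) (n N : nat)
    (a : 'I_n * 'I_N -> {RV P >-> R}) : Prop :=
  (forall ij (B : set R), measurable B ->
     distribution P (a ij) B = normal_prob 0 (Num.sqrt (1 / n%:R)) B) /\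
  mutually_independent a.

Definition random_matrix d (Omega : measurableType d) (R : realType)
    (P : probability Omega R) (n N : nat) (a : 'I_n * 'I_N -> {RV P >-> R})
    (w : Omega) : 'M[R]_(n, N) :=
  \matrix_(i, j) a (i, j) w.

(* The properties G m are not assumed measurable; what is required is that the
   inner probability of [set w | G m w] tends to 1. *)
Definition with_probability_tending_to_1 (R : realType)
    (d : nat -> measure_display) (Omega : forall m, measurableType (d m))
    (P : forall m, probability (Omega m) R) (G : forall m, Omega m -> Prop)
    : Prop :=
  exists E : forall m, set (Omega m),
    [/\ forall m, measurable (E m),
        forall m, E m `<=` [set w | G m w] &
        P m (E m) @[m --> \oo] --> 1%E].

(* Main.v *)
From HB Require Import structures.
Require Import Defs.
From mathcomp Require Import measurable_realfun zify ring lra.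

(** Orthogonal Matching Pursuit recovers every [k]-sparse vector in [k] steps as
soon as [A] is nearly isometric on [(k+1)]-sparse vectors, with a constant [D]
such that [D (1 + sqrt k) < 1]. While the true support is not covered, the
residual is [A w] for a nonzero [w] on that support; the energy [|A w|^2] forces
a correlation of at least [(1 - D) |w| / sqrt k] inside the support, whereas
correlations outside are at most [D |w|] ([correlation_gap]). So each step finds a
new index of the support ([omp_recovers_of_rip]).

A Gaussian matrix has this property with [D] slightly below [1 / sqrt k]. For a
fixed [v], the variable [n |A v|^2 / |v|^2] is chi-square with [n] degrees of
freedom, so that the relative error of [|A v|^2] exceeds [dl] with probability at
most [2 exp (- 0.23 n dl^2)] ([sqnorm_tail]). Independence enters only there: the
entries of [A] are integrated out one at a time, each one being independent of
the sigma-algebra generated by the others. A union bound over rescaled integer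
vectors then controls all sparse vectors ([rip_of_grid]). The number of integer
vectors with at most [q] nonzero entries and squared length at most [q b^2] is at
most [exp (q (ln (N / q) + 2 + b^2))] ([card_sparse_grid]); as [ln (N / q)] tends
to infinity, the price of the net is negligible next to that of the choice of the
support.

It remains to compare the constants. With [dl^2] about [0.9 / k] the union bound
succeeds when [n] exceeds about [4.9 k^2 ln (N / k)]. The hypothesis says that [n]
exceeds [2 k (k - 1) (3 ln (N / k) + 3 - ln (N / n))], where [N / n] is bounded,
hence [5.5 k^2 ln (N / k)] once [k] is large ([omp_regime]). For small [k] the
near isometry is asked at a fixed large order instead, which is a stronger
property and holds because [n / ln N] tends to infinity. *)

Set Implicit Arguments.
Unset Strict Implicit.
Unset Printing Implicit Defensive.
Local Open Scope classical_set_scope.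
Local Open Scope ring_scope.

(** * Gaussian integrals *)

(** [normal_prob] is defined by integrating its density, so the density is a
version of its Radon-Nikodym derivative. *)
Lemma ge0_integral_normal_prob (R : realType) (m s : R)
    (f : measurableTypeR R -> \bar R) :
  (forall x, 0 <= f x)%E -> measurable_fun [set: measurableTypeR R] f ->
  (\int[normal_prob m s]_x f x =
   \int[lebesgue_measure]_x (f x * (normal_pdf m s x)%:E))%E.
Proof.
move=> f0 mf.
rewrite -(Radon_Nikodym_SigmaFinite.change_of_variables
  (normal_prob_dominates m s))//.
apply: ae_eq_integral => //=.
- apply: emeasurable_funM => //.
  apply: measurable_int (Radon_Nikodym_SigmaFinite.f_integrable _).
  exact: normal_prob_dominates.
- apply: emeasurable_funM => //; apply/measurable_EFinP; exact: measurable_normal_pdf.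
- apply: ae_eqe_mul2l.
  apply: integral_ae_eq => //.
  + exact: Radon_Nikodym_SigmaFinite.f_integrable (normal_prob_dominates m s).
  + by apply/measurable_EFinP; exact: measurable_normal_pdf.
  + by move=> E _ mE; rewrite -Radon_Nikodym_SigmaFinite.f_integral//; exact: normal_prob_dominates.
Qed.

(** Multiplying a centred normal density by the exponential of a quadratic
polynomial gives, after completing the square, a multiple of another normal
density. For negative [t] the condition on [1 + 2 t s^2 z^2] is integrability. *)
Lemma integral_normal_expR_sqr (R : realType) (s t z y : R) :
  0 < s -> 0 < 1 + 2 * t * s ^+ 2 * z ^+ 2 ->
  (\int[normal_prob 0 s]_x (expR (- t * (z * x + y) ^+ 2))%:E =
   ((Num.sqrt (1 + 2 * t * s ^+ 2 * z ^+ 2))^-1 *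
     expR (- (t / (1 + 2 * t * s ^+ 2 * z ^+ 2)) * y ^+ 2))%:E)%E.
Proof.
move=> s0; set D := 1 + _ => D0.
have D0' : D != 0 by rewrite gt_eqF.
have s0' : s != 0 by rewrite gt_eqF.
pose s' := s / Num.sqrt D.
have sD0 : 0 < Num.sqrt D by rewrite sqrtr_gt0.
have s'0 : 0 < s' by rewrite divr_gt0.
have s'0' : s' != 0 by rewrite gt_eqF.
have s'2 : s' ^+ 2 = s ^+ 2 / D by rewrite expr_div_n sqr_sqrtr// ltW.
pose c := - (2 * t * z * y * s ^+ 2 / D).
rewrite ge0_integral_normal_prob; last 2 first.
- by move=> x; rewrite lee_fin expR_ge0.
- apply/measurable_EFinP; apply: measurableT_comp => //.
  apply: measurable_funM => //; apply: measurable_funX.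
  by apply: measurable_funD => //; apply: measurable_funM.
transitivity (\int[lebesgue_measure]_x
    (((Num.sqrt D)^-1 * expR (- (t / D) * y ^+ 2))%:E *
     (normal_pdf c s' x)%:E))%E.
  apply: eq_integral => x _; rewrite -!EFinM; congr EFin.
  rewrite !normal_pdfE//= /normal_fun.
  have -> : normal_peak s = (Num.sqrt D)^-1 * normal_peak s'.
    rewrite /normal_peak s'2 -invfM; congr (_^-1).
    rewrite -sqrtrM; last exact: ltW.
    by congr Num.sqrt; field.
  suff H : expR (- t * (z * x + y) ^+ 2) *
      expR (- (x - 0) ^+ 2 / (s ^+ 2 *+ 2)) =
      expR (- (t / D) * y ^+ 2) * expR (- (x - c) ^+ 2 / (s' ^+ 2 *+ 2)).
    by rewrite mulrCA H; ring.
  rewrite -!expRD; congr expR.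
  rewrite s'2 /c /D; field.
  by rewrite s0' /= -/D D0'.
rewrite integralZl//=; last exact: integrable_normal_pdf.
by rewrite integral_normal_pdf mule1.
Qed.

(** * Independence *)

Section independence.
Context d (Omega : measurableType d) (R : realType) (P : probability Omega R).
Context (I : finType) (X : I -> {RV P >-> R}).
Hypothesis Xindep : mutually_independent X.

(** Intersections rather than preimages of single sets: this family is stable
under intersection, as the uniqueness theorem for measures requires. *)
Definition cylinders (J : {set I}) : set (set Omega) :=
  [set A | exists B : I -> set R, (forall i, measurable (B i)) /\
     A = \bigcap_(i in [set` J]) (X i @^-1` B i)].

(** Measurability with respect to the sigma-algebra generated by the [X i],
[i \in J]; stating it as measurability on [g_sigma_algebraType] gives access to
all closure properties of measurable functions. *)
Definition determined_by d' (T : measurableType d') (J : {set I})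
    (V : Omega -> T) :=
  @measurable_fun _ _ (g_sigma_algebraType (cylinders J)) T setT V.

Lemma measurable_preimage_RV i B : measurable B -> measurable (X i @^-1` B).
Proof. by move=> mB; rewrite -[_ @^-1` _]setTI; exact: measurable_funP. Qed.

Lemma cylinders_measurable J : cylinders J `<=` measurable.
Proof.
move=> _ [B [mB ->]]; apply: fin_bigcap_measurable => //.
by move=> i _; exact: measurable_preimage_RV.
Qed.

Lemma cylindersT J : cylinders J setT.
Proof.
exists (fun=> setT); split => //.
by apply/esym; rewrite -subTset => w _ i _.
Qed.

Lemma cylinders_setI J : setI_closed (cylinders J).
Proof.
move=> _ _ [B [mB ->]] [C [mC ->]]; exists (fun i => B i `&` C i); split.
  by move=> i; exact: measurableI.
by rewrite -bigcapI.
Qed.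

Lemma cylindersS (J K : {set I}) : J \subset K -> cylinders J `<=` cylinders K.
Proof.
move=> /fintype.subsetP JK _ [B [mB ->]].
exists (fun i => if i \in J then B i else setT); split.
  by move=> i; case: ifP.
apply/seteqP; split => w h i /= iK; last by have := h i (JK _ iK); rewrite iK.
by case: ifPn => // iJ; exact: h.
Qed.

Lemma determined_byS d' (T : measurableType d') (J K : {set I})
    (V : Omega -> T) :
  J \subset K -> determined_by J V -> determined_by K V.
Proof.
move=> JK mV _ B mB; have := mV measurableT B mB.
exact: (sub_sigma_algebra2 (cylindersS JK)).
Qed.

Lemma determined_byX (J : {set I}) i : i \in J -> determined_by J (X i).
Proof.
move=> iJ _ B mB; apply: sub_sigma_algebra; rewrite setTI.
exists (fun l => if l == i then B else setT); split.
  by move=> l; case: ifP.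
apply/seteqP; split => w /= h.
  by move=> l _ /=; case: eqP => // ->.
by have := h i iJ; rewrite /= eqxx.
Qed.

Lemma determined_measurable d' (T : measurableType d') (J : {set I})
    (V : Omega -> T) :
  determined_by J V -> measurable_fun setT V.
Proof.
move=> mV _ B mB; have := mV measurableT B mB.
apply: smallest_sub; first exact: sigma_algebra_measurable.
exact: cylinders_measurable.
Qed.

(** The product rule for finite families is exactly the claim on cylinders, and
both sides are finite measures in [E]. *)
Lemma indep_cylinders (J : {set I}) (s : I) (B : set R) (E : set Omega) :
  s \notin J -> measurable B -> <<s cylinders J >> E ->
  P (E `&` X s @^-1` B) = (P E * P (X s @^-1` B))%E.
Proof.
move=> sJ mB.
have mXB := measurable_preimage_RV s mB.
have r0 : 0 <= fine (P (X s @^-1` B)) by rewrite fine_ge0.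
pose m1 : {measure set Omega -> \bar R} := mrestr P mXB.
pose m2 : {measure set Omega -> \bar R} := mscale (NngNum r0) P.
have m2E A : m2 A = (P A * P (X s @^-1` B))%E.
  by rewrite /m2 /= /mscale/= fineK ?fin_num_measure// muleC.
rewrite -m2E -[LHS]/(m1 E).
apply: (g_sigma_algebra_measure_unique (cylinders J) _ (fun=> setT)) => //.
- exact: cylinders_measurable.
- by move=> _; exact: cylindersT.
- by rewrite bigcup_const//; exists 0%N.
- exact: cylinders_setI.
- move=> _ [C [mC ->]]; rewrite m2E /m1 /= /mrestr.
  pose C' i := if i == s then B else C i.
  have mC' i : measurable (C' i) by rewrite /C'; case: ifP.
  have -> : \bigcap_(i in [set` J]) X i @^-1` C i `&` X s @^-1` B =
     \bigcap_(i in [set` (s |: J)%SET]) X i @^-1` C' i.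
    apply/seteqP; split => w /=.
      move=> [h1 h2] i /=; rewrite in_setU1 /C'; case: eqP => [-> //|_ /= iJ].
      exact: h1.
    move=> h; split.
      move=> i /= iJ; have := h i; rewrite /= in_setU1 iJ orbT /C'.
      by case: eqP => [is_|_]; [move: iJ; rewrite is_ (negbTE sJ)|exact].
    by have := h s; rewrite /= in_setU1 eqxx /C' eqxx; exact.
  rewrite Xindep// big_setU1//= Xindep// muleC; congr (_ * _)%E.
    apply: eq_bigr => i iJ; rewrite /C'; case: eqP => // is_.
    by move: iJ; rewrite is_ (negbTE sJ).
  by rewrite /C' eqxx.
- move=> _; rewrite /m1/= /mrestr.
  by apply: (le_lt_trans (probability_le1 _ (measurableI _ _ _ _))); rewrite ?ltry.
Qed.

(** By independence the joint law of [V] and [X s] is the product of their laws,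
so [X s] may be integrated out first with [V] frozen. *)
Lemma integral_indep d' (T : measurableType d') (J : {set I}) (s : I)
    (V : Omega -> T) (f : T * R -> \bar R) :
  s \notin J -> determined_by J V ->
  (forall x, 0 <= f x)%E -> measurable_fun setT f ->
  (\int[P]_w f (V w, X s w) =
   \int[P]_w \int[distribution P (X s)]_x f (V w, x))%E.
Proof.
move=> sJ dV f0 mf.
have mV : measurable_fun setT V := determined_measurable dV.
pose Vm := isMeasurableFun.Build _ _ _ _ _ mV.
pose V' : {mfun Omega >-> T} := HB.pack V Vm.
have mVX : measurable_fun setT (fun w => (V w, X s w)).
  exact: measurable_fun_pair.
pose VXm := isMeasurableFun.Build _ _ _ _ _ mVX.
pose VX : {mfun Omega >-> (T * R)%type} :=
  HB.pack (fun w => (V w, X s w)) VXm.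
rewrite -(@ge0_integral_distribution _ _ _ _ _ P VX f)//.
have E : forall A, measurable A ->
   (distribution P V' \x distribution P (X s))%E A = distribution P VX A.
  apply: product_measure_unique => A B mA mB.
  rewrite /distribution /pushforward.
  apply: (indep_cylinders sJ mB).
  by have := dV measurableT A mA; rewrite setTI.
rewrite (eq_measure_integral
  (distribution P V' \x distribution P (X s))%E); last first.
  by move=> A mA _; apply/esym; exact: E.
rewrite fubini_tonelli1// /fubini_F.
rewrite (@ge0_integral_distribution _ _ _ _ _ P V')//.
- exact: measurable_fun_fubini_tonelli_F.
- by move=> y; exact: integral_ge0.
Qed.

End independence.

(** * Quadratic exponentials of independent normal variables *)

Section gaussian_quadratic.
Context d (Omega : measurableType d) (R : realType) (P : probability Omega R).
Context (I : finType) (X : I -> {RV P >-> R}).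
Hypothesis Xindep : mutually_independent X.
Variable sg : R.
Hypothesis sg0 : 0 < sg.
Hypothesis Xnormal : forall i B, measurable B ->
  distribution P (X i) B = normal_prob 0 sg B.

(** The law of [X i] and [normal_prob] live on the same sigma-algebra of the
reals, but under two different measurable-type structures; the pushforward by
the identity passes from one to the other. *)
Lemma integral_distribution_normal (i : I) (f : R -> \bar R) :
  (forall x, 0 <= f x)%E -> measurable_fun setT f ->
  (\int[distribution P (X i)]_x f x = \int[normal_prob 0 sg]_x f x)%E.
Proof.
move=> f0 mf.
have mid : measurable_fun setT (idfun : measurableTypeR R -> R).
  by move=> _ B mB; rewrite setTI.
have := @ge0_integral_pushforward _ _ _ _ R _ mid (normal_prob 0 sg) setT f measurableT mf
  (fun y _ => f0 y).
rewrite preimage_setT => <-.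
by apply: eq_measure_integral => A mA _; exact: Xnormal.
Qed.

Lemma determined_by_sum (J : {set I}) (s : seq I) (z : I -> R) :
  {subset s <= J} -> determined_by X J (fun w => \sum_(i <- s) z i * X i w).
Proof.
elim: s => [|i s IHs] sJ.
  by under eq_fun do rewrite big_nil; exact: measurable_cst.
under eq_fun do rewrite big_cons.
apply: measurable_funD.
  apply: measurable_funM; first exact: measurable_cst.
  by apply: determined_byX; apply: sJ; rewrite mem_head.
by apply: IHs => l ls; apply: sJ; rewrite inE ls orbT.
Qed.

(** Integrating the variables out one at a time keeps the integrand in the same
family: each step only changes [t] into [t / Dj], by
[integral_normal_expR_sqr]. The weight [W] stands for everything that depends on
other variables, such as the other rows of a matrix. *)
Lemma integral_expR_sqr_sum (s : seq I) (J : {set I}) (z : I -> R)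
    (W : Omega -> R) (t : R) :
  uniq s -> (forall i, i \in s -> i \notin J) ->
  determined_by X J W -> (forall w, 0 <= W w) ->
  0 < 1 + 2 * t * sg ^+ 2 * \sum_(i <- s) z i ^+ 2 ->
  (\int[P]_w (expR (- t * (\sum_(i <- s) z i * X i w) ^+ 2) * W w)%:E =
   ((Num.sqrt (1 + 2 * t * sg ^+ 2 * \sum_(i <- s) z i ^+ 2))^-1)%:E *
   \int[P]_w (W w)%:E)%E.
Proof.
elim: s t => [|j s IHs] t.
  move=> _ _ _ _ _; rewrite big_nil mulr0 addr0 sqrtr1 invr1 mul1e.
  by apply: eq_integral => w _; rewrite big_nil expr0n/= mulr0 expR0 mul1r.
rewrite cons_uniq => /andP[js us] sJ mW W0; rewrite big_cons.
set S := \sum_(i <- s) z i ^+ 2 => D0.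
have S0 : 0 <= S by apply: sumr_ge0 => i _; exact: sqr_ge0.
have zj0 : 0 <= z j ^+ 2 by exact: sqr_ge0.
have sg20 : 0 < sg ^+ 2 by exact: exprn_gt0.
set Dj := 1 + 2 * t * sg ^+ 2 * z j ^+ 2.
have Dj0 : 0 < Dj.
  rewrite /Dj; have [t0|t0] := leP 0 t.
    by apply: ltr_wpDr => //; do ?apply: mulr_ge0 => //; exact: ltW.
  apply: (lt_le_trans D0); rewrite lerD2l.
  apply: ler_wnM2l; last by rewrite lerDl.
  by rewrite mulr_le0_ge0 ?(ltW sg20)// mulr_ge0_le0// ltW.
have Dj0' : Dj != 0 by rewrite gt_eqF.
pose K := (J :|: [set i in s])%SET.
pose V w := (\sum_(i <- s) z i * X i w, W w).
have mV : determined_by X K V.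
  apply: measurable_fun_pair.
    by apply: determined_by_sum => i si; rewrite !inE si orbT.
  by apply: determined_byS mW; exact: finset.subsetUl.
have jK : j \notin K.
  by rewrite !inE negb_or js andbT sJ ?mem_head.
(* the maximum with 0 makes [f] nonnegative everywhere, not only on the range of [V] *)
pose f (p : (R * R) * R) : \bar R :=
  (expR (- t * (z j * p.2 + p.1.1) ^+ 2) * Num.max 0 p.1.2)%:E.
have f0 p : (0 <= f p)%E.
  by rewrite lee_fin mulr_ge0 ?expR_ge0// le_max lexx.
have mf : measurable_fun setT f.
  apply/measurable_EFinP; apply: measurable_funM.
    apply: measurableT_comp => //; apply: measurable_funM => //.
    apply: measurable_funX; apply: measurable_funD.
      by apply: measurable_funM => //; exact: measurable_snd.
    by apply: measurableT_comp => //; exact: measurable_fst.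
  apply: measurable_maxr => //.
  by apply: measurableT_comp => //; exact: measurable_fst.
transitivity (\int[P]_w f (V w, X j w))%E.
  apply: eq_integral => w _; rewrite /f /V/= big_cons; congr (_ * _)%:E.
  by rewrite max_r.
rewrite (integral_indep Xindep jK mV f0 mf).
have inner w : (\int[distribution P (X j)]_x f (V w, x) =
    ((Num.sqrt Dj)^-1)%:E *
    (expR (- (t / Dj) * (\sum_(i <- s) z i * X i w) ^+ 2) * W w)%:E)%E.
  transitivity (\int[normal_prob 0 sg]_x f (V w, x))%E.
    rewrite (@integral_distribution_normal _ (fun x => f (V w, x)))//.
    by apply: measurableT_comp => //; exact: measurable_fun_pair.
  transitivity (\int[normal_prob 0 sg]_x
      ((expR (- t * (z j * x + (V w).1) ^+ 2))%:E * (W w)%:E))%E.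
    by apply: eq_integral => x _; rewrite /f/= max_r.
  rewrite ge0_integralZr//=; first last.
  - by rewrite lee_fin.
  - apply/measurable_EFinP; apply: measurableT_comp => //.
    apply: measurable_funM => //.
    by apply: measurable_funX; apply: measurable_funD => //; exact: measurable_funM.
  - rewrite integral_normal_expR_sqr// -!EFinM -/Dj; congr EFin.
    by rewrite -[LHS]mulrA.
transitivity (\int[P]_w (((Num.sqrt Dj)^-1)%:E *
    (expR (- (t / Dj) * (\sum_(i <- s) z i * X i w) ^+ 2) * W w)%:E))%E.
  by apply: eq_integral => w _; exact: inner.
rewrite ge0_integralZl//; first last.
- by move=> w _; rewrite lee_fin mulr_ge0// expR_ge0.
- apply/measurable_EFinP; apply: measurable_funM.
    apply: measurableT_comp => //; apply: measurable_funM => //.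
    apply: measurable_funX.
    apply: (@determined_measurable _ _ _ _ _ X _ _ [set i in s]%SET).
    by apply: determined_by_sum => i si; rewrite inE.
  exact: determined_measurable mW.
have DE : 1 + 2 * t * sg ^+ 2 * (z j ^+ 2 + S) =
    Dj * (1 + 2 * (t / Dj) * sg ^+ 2 * S).
  by rewrite [RHS]mulrDr mulr1 {1}/Dj; field.
have D'0 : 0 < 1 + 2 * (t / Dj) * sg ^+ 2 * S.
  by rewrite -(pmulr_rgt0 _ Dj0) -DE.
rewrite IHs//; last by move=> i si; apply: sJ; rewrite inE si orbT.
by rewrite muleA -EFinM -invfM DE sqrtrM// ltW.
Qed.

End gaussian_quadratic.

(** * Concentration of the length of a Gaussian image *)

(** The square of [l2norm], which spares the square roots. *)
Definition sqnorm (R : realType) n (u : 'cV[R]_n) : R := \sum_(i < n) u i 0 ^+ 2.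

(** The second-order bound [ln (1 + x) >= x - c x^2] for a [c] slightly above 1/2,
valid for negative [x] too as long as [x] is small; [-2/27] is where the
derivative of the difference, [x (2/25 + 27/25 x) / (1 + x)], changes sign
again. *)
Lemma expR_le1Dx (R : realType) (x : R) : - (2 / 27) <= x ->
  expR (x - 27 / 50 * x ^+ 2) <= 1 + x.
Proof.
move=> x0.
have x1 : 0 < 1 + x by lra.
rewrite -[leRHS]lnK ?posrE// ler_expR.
pose g : R -> R := (@ln R \o (cst 1 + id)) - (id - (27 / 50) \*: (id ^+ 2)).
have gE y : g y = ln (1 + y) - (y - 27 / 50 * y ^+ 2) by [].
pose g' (y : R) := (1 + y)^-1 - (1 - 27 / 25 * y).
have dg (y : R) : - (2 / 27) <= y -> is_derive y 1 g (g' y).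
  move=> y0.
  have y1 : 0 < 1 + y by lra.
  have d1 : is_derive y (1 : R) (cst 1 + id) (0 + 1 : R) by exact: is_deriveD.
  have d2 := @is_derive1_comp _ _ _ _ _ _ (is_derive1_ln y1) d1.
  apply: is_derive_eq; rewrite /g' /GRing.scale/=; field.
  by rewrite gt_eqF.
have cg (a b : R) : - (2 / 27) <= a -> {within `[a, b], continuous g}.
  move=> a0; apply: derivable_within_continuous => y; rewrite in_itv/= => /andP[ay _].
  by have [] := dg y (le_trans a0 ay).
have g0 : g 0 = 0 by rewrite gE addr0 ln1 expr0n/= mulr0 !subr0.
suff : 0 <= g x by rewrite gE subr_ge0.
have g'E y : - (2 / 27) <= y -> g' y = y * (2 / 25 + 27 / 25 * y) / (1 + y).
  by move=> y0; rewrite /g'; field; rewrite gt_eqF//; lra.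
have [x00|x00|->] := ltgtP x 0; last by rewrite g0.
- have [|c] := MVT x00 (f := g) (df := g') _ (cg _ _ x0).
    move=> y; rewrite in_itv/= => /andP[y1 _]; apply: dg.
      exact: le_trans x0 (ltW y1).
  rewrite in_itv/= => /andP[xc c0].
  rewrite g0 => gx; have -> : g x = g' c * x by lra.
  rewrite g'E; last lra.
  rewrite mulr_le0//; last exact: ltW.
  rewrite mulr_le0_ge0// ?invr_ge0; last lra.
  by rewrite mulr_le0_ge0//; lra.
- have z0 : - (2 / 27) <= 0 :> R by lra.
  have [|c] := MVT x00 (f := g) (df := g') _ (cg 0 x z0).
    by move=> y; rewrite in_itv/= => /andP[y1 _]; apply: dg; lra.
  rewrite in_itv/= => /andP[xc c0].
  rewrite g0 !subr0 => ->.
  rewrite g'E; last lra.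
  rewrite mulr_ge0//; last exact: ltW.
  rewrite divr_ge0//; last lra.
  by rewrite mulr_ge0//; lra.
Qed.

Section gaussian_matrix.
Context d (Omega : measurableType d) (R : realType) (P : probability Omega R).
Context (n N : nat) (a : 'I_n * 'I_N -> {RV P >-> R}).
Hypothesis n0 : (0 < n)%N.
Hypothesis ha : iid_gaussian_entries a.

Let sg : R := Num.sqrt (1 / n%:R).

Let sg2 : sg ^+ 2 = n%:R^-1.
Proof. by rewrite /sg sqr_sqrtr div1r// invr_ge0. Qed.

Let sg0 : 0 < sg.
Proof. by rewrite /sg sqrtr_gt0 div1r invr_gt0 ltr0n. Qed.

Lemma sqnorm_random_matrixE (v : 'cV[R]_N) w :
  sqnorm (random_matrix a w *m v) =
  \sum_(i < n) (\sum_(j < N) v j 0 * a (i, j) w) ^+ 2.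
Proof.
apply: eq_bigr => i _; rewrite mxE; congr (_ ^+ 2).
by apply: eq_bigr => j _; rewrite mxE mulrC.
Qed.

Lemma measurable_sqnorm (v : 'cV[R]_N) :
  measurable_fun setT (fun w => sqnorm (random_matrix a w *m v)).
Proof.
under eq_fun do rewrite sqnorm_random_matrixE.
apply: measurable_sum => i; apply: measurable_funX.
by apply: measurable_sum => j; apply: measurable_funM.
Qed.

(** The moment generating function of a chi-square variable with [n] degrees of
freedom, obtained row by row. *)
Lemma integral_expR_sqnorm (v : 'cV[R]_N) (t : R) :
  0 < 1 + 2 * t / n%:R * sqnorm v ->
  (\int[P]_w (expR (- t * sqnorm (random_matrix a w *m v)))%:E =
   ((Num.sqrt (1 + 2 * t / n%:R * sqnorm v))^-1 ^+ n)%:E)%E.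
Proof.
move=> D0; case: ha => alaw aindep.
pose row (i : 'I_n) := [seq (i, j) | j <- enum 'I_N].
pose Q w i := (\sum_(p <- row i) v p.2 0 * a p w) ^+ 2.
have QE w i : Q w i = (\sum_(j < N) v j 0 * a (i, j) w) ^+ 2.
  by rewrite /Q big_map big_enum.
pose D := 1 + 2 * t / n%:R * sqnorm v.
have DE i : 1 + 2 * t * sg ^+ 2 * \sum_(p <- row i) v p.2 0 ^+ 2 = D.
  by rewrite /D sg2 big_map big_enum.
suff H (s : seq 'I_n) : uniq s ->
    (\int[P]_w (expR (- t * \sum_(i <- s) Q w i))%:E =
     ((Num.sqrt D)^-1 ^+ size s)%:E)%E.
  have := H (enum 'I_n) (enum_uniq _); rewrite size_enum_ord => <-.
  apply: eq_integral => w _; rewrite sqnorm_random_matrixE big_enum/=.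
  by under [in RHS]eq_bigr do rewrite QE.
elim: s => [_|i s IHs].
  under eq_integral do rewrite big_nil mulr0 expR0.
  by rewrite integral_cst// mul1e expr0; exact: probability_setT.
rewrite cons_uniq => /andP[iS us].
transitivity (\int[P]_w (
    expR (- t * (\sum_(p <- row i) v p.2 0 * a p w) ^+ 2) *
    expR (- t * \sum_(i <- s) Q w i))%:E)%E.
  by apply: eq_integral => w _; rewrite big_cons mulrDr expRD.
rewrite (integral_expR_sqr_sum aindep sg0 alaw (J := [set p | p.1 \in s]%SET))//.
- by rewrite (DE i) IHs// -EFinM exprS.
- by rewrite map_inj_uniq ?enum_uniq// => j1 j2 [].
- by move=> p /mapP[j _ ->]; rewrite inE.
- apply: measurableT_comp => //; apply: measurable_funM => //.
  suff dQ (l : seq 'I_n) : {subset l <= s} ->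
      determined_by a [set p | p.1 \in s]%SET (fun w => \sum_(i <- l) Q w i).
    exact: dQ.
  elim: l => [|l l' IH] ls.
    have -> : (fun w => \sum_(i <- [::]) Q w i) = cst 0.
      by apply/funext => w; rewrite big_nil.
    exact: measurable_cst.
  have -> : (fun w => \sum_(i <- l :: l') Q w i) =
      (fun w => Q w l + \sum_(i <- l') Q w i).
    by apply/funext => w; rewrite big_cons.
  apply: measurable_funD; last by apply: IH => x xs; apply: ls; rewrite inE xs orbT.
  apply: measurable_funX; apply: determined_by_sum => p /mapP[j _ ->].
  by rewrite inE/= ls// mem_head.
- by have := D0; rewrite -/D -(DE i).
Qed.

(** Chernoff bounds for both tails at once: for [x > 0] the event says that
[|Av|^2] is at most [(1 - x) |v|^2], for [x < 0] that it is at least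
[(1 + |x|) |v|^2]. The exponent 23/100 is close to the optimal 1/4, and this
matters: the final comparison of constants fails for exponents below 1/6. *)
Lemma sqnorm_tail (v : 'cV[R]_N) (x : R) : 0 < sqnorm v -> - (2 / 27) <= x ->
  (P [set w |
      (x * sqnorm (random_matrix a w *m v) <= x * (1 - x) * sqnorm v)%R] <=
   (expR (- (23 / 100) * n%:R * x ^+ 2))%:E)%E.
Proof.
set q := sqnorm v => q0 x0; set F := [set w | _].
have x1 : 0 < 1 + x by lra.
have n0' : 0 < n%:R :> R by rewrite ltr0n.
(* the minimizer of the exponential bound, to first order in [x] *)
pose t := n%:R * x / (2 * q).
have DE : 1 + 2 * t / n%:R * q = 1 + x by rewrite /t; field; rewrite !gt_eqF.
have mF : measurable F.
  rewrite /F -[X in measurable X]setTI.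
  apply: measurable_fun_le => //; apply: measurable_funM => //.
  exact: measurable_sqnorm.
pose c := expR (- (n%:R / 2 * x * (1 - x))).
have c0 : 0 < c by exact: expR_gt0.
have key : (c%:E * P F <= ((Num.sqrt (1 + x))^-1 ^+ n)%:E)%E.
  rewrite -DE -integral_expR_sqnorm ?DE//.
  rewrite -[in leLHS](setIT F) -integral_indic// -ge0_integralZl//; last 2 first.
  - by apply/measurable_EFinP; exact: measurable_indic.
  - by rewrite lee_fin ltW.
  apply: ge0_le_integral => //.
  - by move=> w _; rewrite mule_ge0// lee_fin// ltW.
  - apply: emeasurable_funM => //; apply/measurable_EFinP.
    exact: measurable_indic.
  - apply/measurable_EFinP; apply: measurableT_comp => //.
    by apply: measurable_funM => //; exact: measurable_sqnorm.
  - move=> w _; rewrite -EFinM lee_fin indicE.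
    have [wF|wF] := boolP (w \in F); last first.
      by rewrite mulr0 expR_ge0.
    rewrite mulr1 ler_expR mulNr lerN2.
    move: wF; rewrite inE /F/= => wF.
    have -> : t * sqnorm (random_matrix a w *m v) =
        n%:R / (2 * q) * (x * sqnorm (random_matrix a w *m v)).
      by rewrite /t; ring.
    have -> : n%:R / 2 * x * (1 - x) = n%:R / (2 * q) * (x * (1 - x) * q).
      by field; rewrite gt_eqF.
    by rewrite ler_pM2l// divr_gt0// mulr_gt0.
have PF : P F = (fine (P F))%:E by rewrite fineK// fin_num_measure.
move: key; rewrite PF -EFinM !lee_fin => key.
rewrite -(ler_pM2l c0); apply: (le_trans key).
rewrite /c -expRD.
have -> : - (n%:R / 2 * x * (1 - x)) + - (23 / 100) * n%:R * x ^+ 2 =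
   n%:R * (- ((x - 27 / 50 * x ^+ 2) / 2)) :> R by field.
rewrite expRM_natl; apply: lerXn2r; rewrite ?nnegrE ?expR_ge0 ?invr_ge0 ?sqrtr_ge0//.
rewrite expRN lef_pV2 ?posrE ?expR_gt0 ?sqrtr_gt0//.
rewrite -ler_sqr ?nnegrE ?expR_ge0 ?sqrtr_ge0// sqr_sqrtr; last exact: ltW.
by rewrite -expRM_natl mulrC divfK//; exact: expR_le1Dx.
Qed.

End gaussian_matrix.

(** * Restricted isometry and nets *)

Section inner_product.
Context (R : realType).

Lemma cauchy_schwarz_sum (I : finType) (A : {set I}) (f g : I -> R) :
  (\sum_(i in A) f i * g i) ^+ 2 <=
  (\sum_(i in A) f i ^+ 2) * (\sum_(i in A) g i ^+ 2).
Proof.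
set a := \sum_(i in A) f i ^+ 2; set b := \sum_(i in A) g i ^+ 2.
set c := \sum_(i in A) f i * g i.
have b0 : 0 <= b by apply: sumr_ge0 => i _; exact: sqr_ge0.
have [b00|b00] := eqVneq b 0.
  have g0 i : i \in A -> g i = 0.
    move=> iA; apply/eqP; rewrite -sqrf_eq0; apply/eqP.
    by have /psumr_eq0P := b00; apply => // l _; exact: sqr_ge0.
  by rewrite b00 mulr0 /c big1 ?expr0n// => i iA; rewrite g0// mulr0.
have bp : 0 < b by rewrite lt_def b00.
have : 0 <= \sum_(i in A) (b * f i - c * g i) ^+ 2.
  by apply: sumr_ge0 => i _; exact: sqr_ge0.
have -> : \sum_(i in A) (b * f i - c * g i) ^+ 2 = b * (a * b - c ^+ 2).
  rewrite (eq_bigr (fun i => b ^+ 2 * f i ^+ 2 +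
    (- (2 * b * c) * (f i * g i) + c ^+ 2 * g i ^+ 2))); last by move=> i _; ring.
  by rewrite !big_split/= -!mulr_sumr -/a -/b -/c; ring.
by rewrite pmulr_rge0// subr_ge0.
Qed.

Lemma sqnormE n (u : 'cV[R]_n) : sqnorm u = dotp u u.
Proof. by apply: eq_bigr => i _; rewrite expr2. Qed.

Lemma sqnorm_ge0 n (u : 'cV[R]_n) : 0 <= sqnorm u.
Proof. by apply: sumr_ge0 => i _; exact: sqr_ge0. Qed.

Lemma sqnorm0 n : sqnorm (0 : 'cV[R]_n) = 0.
Proof. by rewrite /sqnorm big1// => i _; rewrite mxE expr0n. Qed.

Lemma sqnorm_eq0 n (u : 'cV[R]_n) : sqnorm u = 0 -> u = 0.
Proof.
move=> u0; apply/matrixP => i j; rewrite ord1 mxE.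
apply/eqP; rewrite -sqrf_eq0; apply/eqP.
by have /psumr_eq0P := u0; apply => // l _; exact: sqr_ge0.
Qed.

Lemma sqnorm_gt0 n (u : 'cV[R]_n) : u != 0 -> 0 < sqnorm u.
Proof.
move=> u0; rewrite lt_def sqnorm_ge0 andbT.
by apply: contra u0 => /eqP /sqnorm_eq0 ->.
Qed.

Lemma dotpC n (u v : 'cV[R]_n) : dotp u v = dotp v u.
Proof. by apply: eq_bigr => i _; rewrite mulrC. Qed.

Lemma dotpDl n (u v w : 'cV[R]_n) : dotp (u + v) w = dotp u w + dotp v w.
Proof. by rewrite -big_split; apply: eq_bigr => i _; rewrite mxE mulrDl. Qed.

Lemma dotpZl n c (u v : 'cV[R]_n) : dotp (c *: u) v = c * dotp u v.
Proof. by rewrite mulr_sumr; apply: eq_bigr => i _; rewrite mxE mulrA. Qed.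

Lemma dotpNl n (u v : 'cV[R]_n) : dotp (- u) v = - dotp u v.
Proof. by rewrite -scaleN1r dotpZl mulN1r. Qed.

Lemma dotpDr n (u v w : 'cV[R]_n) : dotp w (u + v) = dotp w u + dotp w v.
Proof. by rewrite dotpC dotpDl !(dotpC w). Qed.

Lemma dotpZr n c (u v : 'cV[R]_n) : dotp v (c *: u) = c * dotp v u.
Proof. by rewrite dotpC dotpZl dotpC. Qed.

Lemma dotpNr n (u v : 'cV[R]_n) : dotp v (- u) = - dotp v u.
Proof. by rewrite dotpC dotpNl dotpC. Qed.

Definition dotpE := (dotpDl, dotpDr, dotpNl, dotpNr, dotpZl, dotpZr).

Lemma dotp_trmx n N (A : 'M[R]_(n, N)) u v : dotp (A^T *m u) v = dotp u (A *m v).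
Proof.
rewrite /dotp; under eq_bigr do rewrite mxE mulr_suml.
rewrite exchange_big; apply: eq_bigr => i _; rewrite mxE mulr_sumr.
by apply: eq_bigr => j _; rewrite mxE; ring.
Qed.

Lemma dotp_col n N (A : 'M[R]_(n, N)) u j : dotp (col j A) u = (A^T *m u) j 0.
Proof. by rewrite mxE; apply: eq_bigr => i _; rewrite !mxE. Qed.

Lemma dotp_delta n (u : 'cV[R]_n) j : dotp (delta_mx j 0) u = u j 0.
Proof.
rewrite /dotp (bigD1 j)//= big1 ?addr0 => [|i ij].
  by rewrite mxE !eqxx mul1r.
by rewrite mxE (negbTE ij) mul0r.
Qed.

Lemma dotp_supp n (u v : 'cV[R]_n) (T : {set 'I_n}) : vsupp u \subset T ->
  dotp u v = \sum_(i in T) u i 0 * v i 0.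
Proof.
move=> /fintype.subsetP uT; rewrite [RHS]big_mkcond; apply: eq_bigr => i _.
case: ifPn => // iT; suff -> : u i 0 = 0 by rewrite mul0r.
by apply/eqP; apply: contraNT iT => ui; apply: uT; rewrite inE.
Qed.

Lemma sqnorm_supp n (u : 'cV[R]_n) (T : {set 'I_n}) : vsupp u \subset T ->
  sqnorm u = \sum_(i in T) u i 0 ^+ 2.
Proof.
by move=> uT; rewrite sqnormE (dotp_supp _ uT); apply: eq_bigr => i _; rewrite expr2.
Qed.

Lemma vsuppP n (u : 'cV[R]_n) (T : {set 'I_n}) :
  reflect (forall i, i \notin T -> u i 0 = 0) (vsupp u \subset T).
Proof.
apply: (iffP fintype.subsetP) => uT i.
  by move=> iT; apply/eqP; apply: contraNT iT => ui; apply: uT; rewrite inE.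
by rewrite inE; apply: contraNT => /uT ->.
Qed.

Lemma vsuppD n (u v : 'cV[R]_n) (T : {set 'I_n}) :
  vsupp u \subset T -> vsupp v \subset T -> vsupp (u + v) \subset T.
Proof.
move=> /vsuppP uT /vsuppP vT; apply/vsuppP => i iT.
by rewrite mxE uT// vT// addr0.
Qed.

Lemma vsuppZ n c (u : 'cV[R]_n) (T : {set 'I_n}) :
  vsupp u \subset T -> vsupp (c *: u) \subset T.
Proof. by move=> /vsuppP uT; apply/vsuppP => i iT; rewrite mxE uT// mulr0. Qed.

Lemma vsuppB n (u v : 'cV[R]_n) (T : {set 'I_n}) :
  vsupp u \subset T -> vsupp v \subset T -> vsupp (u - v) \subset T.
Proof. by move=> uT vT; rewrite -scaleN1r vsuppD// vsuppZ. Qed.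

Lemma le_l2norm n (u v : 'cV[R]_n) : (l2norm u <= l2norm v) = (sqnorm u <= sqnorm v).
Proof. by rewrite /l2norm ler_sqrt//; exact: sqnorm_ge0. Qed.

End inner_product.

Section restricted_isometry.
Context (R : realType) (n N : nat) (A : 'M[R]_(n, N)).

(** The restricted isometry property of order [q] with constant [D]. *)
Definition rip (q : nat) (D : R) := forall v : 'cV[R]_N, (#|vsupp v| <= q)%N ->
  `|sqnorm (A *m v) - sqnorm v| <= D * sqnorm v.

(** Polarization of the quadratic bound. The free parameter [c] replaces the
product of the two norms: optimizing over it gives [D |u| |v|]. *)
Lemma rip_bilinear q D (S : {set 'I_N}) (u v : 'cV[R]_N) (c : R) :
  rip q D -> (#|S| <= q)%N -> vsupp u \subset S -> vsupp v \subset S -> 0 < c ->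
  `|dotp (A *m u) (A *m v) - dotp u v| <= D * (c * sqnorm u + sqnorm v / c) / 2.
Proof.
move=> ripA Sq uS vS c0.
have h (w : 'cV[R]_N) : vsupp w \subset S -> `|sqnorm (A *m w) - sqnorm w| <= D * sqnorm w.
  by move=> wS; apply: ripA; apply: leq_trans (subset_leq_card wS) Sq.
have hp := h _ (vsuppD (vsuppZ c uS) vS).
have hm := h _ (vsuppB (vsuppZ c uS) vS).
have -> : dotp (A *m u) (A *m v) - dotp u v =
   ((sqnorm (A *m (c *: u + v)) - sqnorm (c *: u + v)) -
    (sqnorm (A *m (c *: u - v)) - sqnorm (c *: u - v))) / (4 * c).
  rewrite !sqnormE !(mulmxDr, mulmxBr, mulmxN) -!scalemxAr !dotpE.
  rewrite (dotpC (A *m v) (A *m u)) (dotpC v u); field.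
  by rewrite gt_eqF.
have c4 : 0 < 4 * c by rewrite mulr_gt0.
rewrite normrM (ger0_norm (_ : 0 <= (4 * c)^-1)) ?invr_ge0 ?(ltW c4)// ler_pdivrMr//.
apply: (le_trans (ler_normB _ _)); apply: (le_trans (lerD hp hm)).
rewrite !sqnormE !dotpE (dotpC v u) le_eqVlt; apply/orP; left; apply/eqP; field.
by rewrite gt_eqF.
Qed.

Lemma rip_inj q D (v : 'cV[R]_N) : rip q D -> D < 1 -> (#|vsupp v| <= q)%N ->
  A *m v = 0 -> v = 0.
Proof.
move=> ripA D1 vq Av; have := ripA v vq.
rewrite Av sqnorm0 sub0r normrN ger0_norm ?sqnorm_ge0// => h; apply: sqnorm_eq0.
have := sqnorm_ge0 v; nra.
Qed.

(** Inside the support, the energy identity [|Aw|^2 = \sum_i w_i <a_i, Aw>] and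
Cauchy-Schwarz force some correlation to be at least [(1 - D) |w| / sqrt k];
outside, [a_l = A e_l] with [e_l] orthogonal to [w], so polarization bounds the
correlation by [D |w|]. *)
Lemma correlation_gap k D (T : {set 'I_N}) (w : 'cV[R]_N) (l : 'I_N) :
  rip k.+1 D -> 0 <= D < 1 -> D ^+ 2 * k%:R < (1 - D) ^+ 2 ->
  (#|T| <= k)%N -> vsupp w \subset T -> w != 0 -> l \notin T ->
  exists2 i, i \in T & `|dotp (col l A) (A *m w)| < `|dotp (col i A) (A *m w)|.
Proof.
move=> ripA /andP[D0 D1] Dk Tk wT w0 lT.
apply: contrapT => /forallPNP H.
pose c := A^T *m (A *m w).
pose m := `|c l 0|.
have cm i : i \in T -> c i 0 ^+ 2 <= m ^+ 2.
  move=> iT; have := H i iT; rewrite !dotp_col -/c => /negP; rewrite -leNgt => h.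
  by rewrite -[leLHS]real_normK ?num_real// lerXn2r// nnegrE normr_ge0.
have wp := sqnorm_gt0 w0.
have Aw : (sqnorm (A *m w)) ^+ 2 <= sqnorm w * (k%:R * m ^+ 2).
  rewrite sqnormE -dotp_trmx dotpC (dotp_supp _ wT).
  apply: (le_trans (cauchy_schwarz_sum _ _ _)).
  rewrite -(sqnorm_supp wT) ler_wpM2l ?sqnorm_ge0//.
  apply: (@le_trans _ _ (\sum_(i in T) m ^+ 2)); first by apply: ler_sum => i iT; exact: cm.
  by rewrite sumr_const -[leLHS]mulr_natl ler_wpM2r ?sqr_ge0// ler_nat.
have Awl : (1 - D) * sqnorm w <= sqnorm (A *m w).
  have := ripA w (leq_trans (subset_leq_card wT) (leq_trans Tk (leqnSn _))).
  by rewrite ler_norml => /andP[]; lra.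
have mD : m ^+ 2 <= D ^+ 2 * sqnorm w.
  pose s := Num.sqrt (sqnorm w).
  have s0 : 0 < s by rewrite sqrtr_gt0.
  have s2 : s ^+ 2 = sqnorm w by rewrite sqr_sqrtr// ltW.
  have lTq : (#|(l |: T)%SET| <= k.+1)%N by rewrite cardsU1 lT.
  have lS : vsupp (delta_mx l 0 : 'cV[R]_N) \subset (l |: T)%SET.
    by apply/vsuppP => i; rewrite !inE negb_or mxE => /andP[/negbTE -> _].
  have wS : vsupp w \subset (l |: T)%SET.
    by apply: fintype.subset_trans wT (finset.subsetUr _ _).
  have := rip_bilinear ripA lTq lS wS s0.
  have -> : dotp (A *m delta_mx l 0) (A *m w) = c l 0.
    by rewrite dotpC -dotp_trmx -/c dotpC dotp_delta.
  rewrite dotp_delta; have -> : w l 0 = 0 by have /vsuppP := wT; apply.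
  have -> : sqnorm (delta_mx l 0 : 'cV[R]_N) = 1 by rewrite sqnormE dotp_delta mxE !eqxx.
  rewrite subr0 mulr1 -s2 expr2 mulfK ?gt_eqF//.
  have -> : D * (s + s) / 2 = D * s by field.
  by move=> h; rewrite -expr2 -exprMn lerXn2r ?nnegrE ?normr_ge0 ?mulr_ge0 ?(ltW s0).
have : ((1 - D) * sqnorm w) ^+ 2 <= (sqnorm (A *m w)) ^+ 2.
  by rewrite lerXn2r ?nnegrE ?sqnorm_ge0// mulr_ge0 ?sqnorm_ge0//; lra.
move=> /le_trans /(_ Aw) h.
have : ((1 - D) * sqnorm w) ^+ 2 <= sqnorm w * (k%:R * (D ^+ 2 * sqnorm w)).
  by apply: (le_trans h); rewrite ler_pM2l// ler_wpM2l.
rewrite (_ : sqnorm w * _ = D ^+ 2 * k%:R * sqnorm w ^+ 2); last by ring.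
by rewrite exprMn ler_pM2r ?exprn_gt0// leNgt Dk.
Qed.

(** The constant is poor, but it shows that some constant exists, from which
[rip_of_grid] starts. *)
Lemma rip_frobenius q : rip q (1 + \sum_(i < n) \sum_(j < N) A i j ^+ 2).
Proof.
move=> v _; rewrite mulrDl mul1r [leRHS]addrC.
apply: (le_trans (ler_normB _ _)).
rewrite !ger0_norm ?sqnorm_ge0// lerD2r mulr_suml; apply: ler_sum => i _.
rewrite mxE.
have := cauchy_schwarz_sum [set: 'I_N]%SET (A i) (fun j => v j 0).
have sumT (F : 'I_N -> R) : \sum_(j in [set: 'I_N]%SET) F j = \sum_(j < N) F j.
  by apply: eq_bigl => j; rewrite inE.
by rewrite !sumT.
Qed.

Lemma ripS q D D' : D <= D' -> rip q D -> rip q D'.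
Proof.
by move=> DD' ripA v vq; apply: (le_trans (ripA v vq)); rewrite ler_wpM2r ?sqnorm_ge0.
Qed.

End restricted_isometry.

(** Rounding towards 0. *)
Lemma trunc_int (R : realType) (y : R) :
  {m : int | `|m%:~R| <= `|y| & `|y - m%:~R| <= 1}.
Proof.
have pos (x : R) : 0 <= x -> {m : int | `|m%:~R| <= `|x| & `|x - m%:~R| <= 1}.
  move=> x0; exists (Num.floor x).
    by rewrite !ger0_norm ?floor_le_tmp// ler0z floor_ge0.
  have := floor_itv x; rewrite intrD => /andP[h1 h2].
  by rewrite ger0_norm; lra.
have [y0|y0] := leP 0 y; first exact: pos.
have [|m h1 h2] := pos (- y); first by lra.
exists (- m); rewrite rmorphN/= ?normrN; first by rewrite normrN in h1.
by rewrite -normrN opprB addrC.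
Qed.

Section net.
Context (R : realType) (n N : nat) (A : 'M[R]_(n, N)).

Let Q (v : 'cV[R]_N) := sqnorm (A *m v) - sqnorm v.

(** The isometry bound on integer vectors only. Divided by [b sqrt q], the
integer vectors considered form a [1/b]-net of the unit ball on each set of [q]
coordinates. *)
Definition grid_rip (q b : nat) (dl : R) :=
  forall m : 'cV[int]_N, (#|[set j | (m j 0 != 0)%R]%SET| <= q)%N ->
     \sum_(j < N) m j 0 ^+ 2 <= (q * b ^ 2)%:Z ->
     let v := map_mx (fun x : int => x%:~R : R) m in
     `|sqnorm (A *m v) - sqnorm v| <= dl * sqnorm v.

Lemma sqnormZ k c (v : 'cV[R]_k) : sqnorm (c *: v) = c ^+ 2 * sqnorm v.
Proof. by rewrite !sqnormE !dotpE; ring. Qed.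

Let defect_diff (u v : 'cV[R]_N) :
  dotp (A *m (u - v)) (A *m (u + v)) - dotp (u - v) (u + v) = Q u - Q v.
Proof.
by rewrite /Q !sqnormE mulmxBr mulmxDr !dotpE (dotpC v u) (dotpC (A *m v)); ring.
Qed.

(** Rounding [x] towards 0 on a grid of mesh [r = |x| / (b sqrt q)] gives a grid
vector [z] with support in that of [x], no longer than [x], and at distance at
most [|x| / b]. The isometry defects of [x] and [z] differ by a bilinear
expression in [x - z] and [x + z], which any constant [M] already known
controls. *)
Lemma rip_grid_step (q b : nat) (dl M : R) : (0 < q)%N -> (0 < b)%N ->
  grid_rip q b dl -> 0 <= dl -> 0 <= M -> rip A q M -> rip A q (dl + 2 / b%:R * M).
Proof.
move=> q0 b0 grid dl0 M0 ripA x xq.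
have [->|x0] := eqVneq x 0.
  by rewrite mulmx0 !sqnorm0 subrr normr0 mulr0.
have xp := sqnorm_gt0 x0.
have b0' : 0 < b%:R :> R by rewrite ltr0n.
have q0' : 0 < q%:R :> R by rewrite ltr0n.
pose r := Num.sqrt (sqnorm x / (q%:R * b%:R ^+ 2)).
have r2 : r ^+ 2 = sqnorm x / (q%:R * b%:R ^+ 2).
  by rewrite sqr_sqrtr// divr_ge0 ?(ltW xp)// mulr_ge0// ?ltW// exprn_ge0// ltW.
have r0 : 0 < r by rewrite sqrtr_gt0 divr_gt0// mulr_gt0// exprn_gt0.
pose mf j := s2val (trunc_int (x j 0 / r)).
have mf1 j : `|r * (mf j)%:~R| <= `|x j 0|.
  have := s2valP (trunc_int (x j 0 / r)); rewrite -/(mf j) normf_div.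
  by rewrite (gtr0_norm r0) ler_pdivlMr// normrM (gtr0_norm r0) mulrC.
have mf2 j : `|x j 0 - r * (mf j)%:~R| <= r.
  have := s2valP' (trunc_int (x j 0 / r)); rewrite -/(mf j).
  have -> : x j 0 - r * (mf j)%:~R = r * (x j 0 / r - (mf j)%:~R).
    by field; rewrite gt_eqF.
  by rewrite normrM (gtr0_norm r0) => h; rewrite -[leRHS]mulr1 ler_wpM2l// ltW.
pose m : 'cV[int]_N := \col_j mf j.
pose z := r *: map_mx (fun x : int => x%:~R : R) m.
have zE j : z j 0 = r * (mf j)%:~R by rewrite !mxE.
have mx j : m j 0 != 0 -> j \in vsupp x.
  rewrite mxE inE; apply: contra => /eqP xj; have := mf1 j.
  by rewrite xj normr0 normr_le0 mulf_eq0 gt_eqF//= intr_eq0.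
have mq : (#|[set j | (m j 0 != 0)%R]%SET| <= q)%N.
  apply: leq_trans xq; apply: subset_leq_card; apply/fintype.subsetP => j.
  by rewrite inE; exact: mx.
have zS : vsupp z \subset vsupp x.
  apply/fintype.subsetP => j; rewrite inE => zj; apply: mx; apply: contra zj.
  by rewrite zE !mxE => /eqP ->; rewrite mulr0.
have xS : vsupp x \subset vsupp x by [].
have zx : sqnorm z <= sqnorm x.
  apply: ler_sum => j _; rewrite -real_normK ?num_real// -[leRHS]real_normK ?num_real//.
  by rewrite lerXn2r ?nnegrE// zE.
have zm : sqnorm z = r ^+ 2 * (\sum_(j < N) m j 0 ^+ 2)%:~R.
  rewrite sqnormZ /sqnorm rmorph_sum; congr (_ * _); apply: eq_bigr => j _.
  by rewrite !mxE rmorphXn.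
have msum : \sum_(j < N) m j 0 ^+ 2 <= (q * b ^ 2)%:Z.
  rewrite -(ler_int R) -(ler_pM2l (exprn_gt0 2 r0)) -zm; apply: (le_trans zx).
  rewrite r2 -pmulrn natrM natrX divfK// gt_eqF// mulr_gt0// exprn_gt0//.
have Qz : `|Q z| <= dl * sqnorm z.
  have := grid m mq msum; set v := map_mx _ m => /= h.
  rewrite /Q /z -/v -scalemxAr !sqnormZ -mulrBr normrM (ger0_norm (sqr_ge0 r)).
  by rewrite mulrCA ler_wpM2l// sqr_ge0.
have dz : sqnorm (x - z) <= sqnorm x / b%:R ^+ 2.
  have dS := vsuppB xS zS.
  rewrite (sqnorm_supp dS).
  apply: (@le_trans _ _ (\sum_(i in vsupp x) r ^+ 2)).
    apply: ler_sum => j _; rewrite -real_normK ?num_real// lerXn2r ?nnegrE ?(ltW r0)//.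
    by have := mf2 j; rewrite !mxE.
  rewrite sumr_const -[leLHS]mulr_natl r2.
  apply: (@le_trans _ _ (q%:R * (sqnorm x / (q%:R * b%:R ^+ 2)))).
    by rewrite -r2 ler_wpM2r ?sqr_ge0// ler_nat.
  rewrite le_eqVlt; apply/orP; left; apply/eqP; field.
  by rewrite !gt_eqF.
have sz : sqnorm (x + z) <= 4 * sqnorm x.
  rewrite /sqnorm mulr_sumr; apply: ler_sum => j _.
  have -> : 4 * x j 0 ^+ 2 = (2 * `|x j 0|) ^+ 2.
    by rewrite exprMn real_normK ?num_real//; ring.
  rewrite -real_normK ?num_real// lerXn2r ?nnegrE ?mulr_ge0//.
  rewrite mxE; apply: (le_trans (ler_normD _ _)).
  by have := mf1 j; rewrite -zE; lra.
(* this parameter balances [|x - z| <= |x| / b] against [|x + z| <= 2 |x|] *)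
have c0 : 0 < 2 * b%:R :> R by rewrite mulr_gt0.
have := rip_bilinear ripA xq (vsuppB xS zS) (vsuppD xS zS) c0.
have -> : dotp (A *m (x - z)) (A *m (x + z)) - dotp (x - z) (x + z) = Q x - Q z.
  exact: defect_diff.
rewrite -/(Q x) => h.
have h2 : M * (2 * b%:R * sqnorm (x - z) + sqnorm (x + z) / (2 * b%:R)) / 2 <=
    2 / b%:R * M * sqnorm x.
  have -> : 2 / b%:R * M * sqnorm x =
     M * (2 * b%:R * (sqnorm x / b%:R ^+ 2) + 4 * sqnorm x / (2 * b%:R)) / 2.
    by field; rewrite gt_eqF.
  rewrite ler_pM2r ?invr_gt0// ler_wpM2l// lerD//.
    by rewrite ler_pM2l.
  by rewrite ler_pM2r ?invr_gt0.
have h3 : dl * sqnorm z <= dl * sqnorm x by rewrite ler_wpM2l.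
have -> : Q x = (Q x - Q z) + Q z by ring.
apply: (le_trans (ler_normD _ _)); rewrite mulrDl.
by rewrite addrC lerD// ?(le_trans Qz)// (le_trans h).
Qed.

(** The least isometry constant [M] satisfies [M <= dl + (2 / b) M]. *)
Lemma rip_of_grid (q b : nat) (dl : R) : (0 < q)%N -> (2 < b)%N -> 0 <= dl ->
  grid_rip q b dl -> rip A q (dl / (1 - 2 / b%:R)).
Proof.
move=> q0 b2 dl0 grid.
have b0 : (0 < b)%N by exact: ltn_trans b2.
have b0' : 0 < b%:R :> R by rewrite ltr0n.
have b1 : 2 / b%:R < 1 :> R by rewrite ltr_pdivrMr// mul1r (ltr_nat _ 2).
pose S := [set M : R | 0 <= M /\ rip A q M].
have S0 : S !=set0.
  exists (1 + \sum_(i < n) \sum_(j < N) A i j ^+ 2); split; last exact: rip_frobenius.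
  by rewrite addr_ge0// sumr_ge0// => i _; rewrite sumr_ge0// => j _; exact: sqr_ge0.
have lS : has_lbound S by exists 0 => M [].
have M0 : 0 <= inf S by apply: lb_le_inf => // M [].
have ripM : rip A q (inf S).
  move=> v vq; have [->|v0] := eqVneq v 0.
    by rewrite mulmx0 !sqnorm0 subrr normr0 mulr0.
  have vp := sqnorm_gt0 v0.
  rewrite -ler_pdivrMr//; apply: lb_le_inf => // M [_ ripA].
  by rewrite ler_pdivrMr//; exact: ripA.
have h : inf S <= dl + 2 / b%:R * inf S.
  apply: ge_inf => //; split; last exact: rip_grid_step.
  by rewrite addr_ge0// mulr_ge0// divr_ge0// ltW.
apply: ripS ripM; rewrite ler_pdivlMr; last by rewrite subr_gt0.
by rewrite mulrBr mulr1 lerBlDr (mulrC (inf S)).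
Qed.

End net.

(** * Orthogonal Matching Pursuit under restricted isometry *)

Section least_squares.
Context (R : realType) (n N : nat) (A : 'M[R]_(n, N)).
Context (q : nat) (D : R).
Hypothesis ripA : rip A q D.
Hypothesis D1 : D < 1.

(** The normal equations of the least-squares problem on the support [T]. *)
Definition normal_eq (y : 'cV[R]_n) (T : {set 'I_N}) (x : 'cV[R]_N) :=
  vsupp x \subset T /\ forall j, j \in T -> dotp (col j A) (y - A *m x) = 0.

(** With [E] the coordinate projection onto [T], the matrix
[E A^T A E + (1 - E)] is invertible because [A] is injective on vectors
supported on [T], and inverting it solves the equations within the support. *)
Lemma exists_normal_eq y (T : {set 'I_N}) : (#|T| <= q)%N -> exists x, normal_eq y T x.
Proof.
move=> Tq.
pose E : 'M[R]_N := diag_mx (\row_j (j \in T)%:R).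
have Ee (u : 'cV[R]_N) j : (E *m u) j 0 = (j \in T)%:R * u j 0.
  by rewrite mul_diag_mx !mxE.
have ET : E^T = E by rewrite tr_diag_mx.
have Esupp (u : 'cV[R]_N) : vsupp (E *m u) \subset T.
  by apply/vsuppP => j jT; rewrite Ee (negbTE jT) mul0r.
pose M := E *m A^T *m A *m E + (1%:M - E).
have MT : M^T = M.
  by rewrite /M !linearD/= linearN/= trmx1 ET !trmx_mul trmxK ET !mulmxA.
have Mu : M \in unitmx.
  rewrite unitmxE unitfE; apply/det0P => -[v v0 vM].
  pose u := v^T.
  have Mu0 : M *m u = 0 by rewrite -MT -trmx_mul vM trmx0.
  have Eu : A *m (E *m u) = 0 /\ (1%:M - E) *m u = 0.
    have h1 : E *m (M *m u) = 0 by rewrite Mu0 mulmx0.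
    have EE : E *m E = E.
      apply/matrixP => i j; rewrite mul_diag_mx !mxE.
      by case: (i \in T); rewrite ?mul1r ?mul0r//= mul0rn.
    have EE0 : E *m (1%:M - E) = 0 by rewrite mulmxBr mulmx1 EE subrr.
    have h2 : E *m A^T *m A *m E *m u = 0.
      by move: h1; rewrite /M mulmxDl mulmxDr !mulmxA EE EE0 mul0mx addr0.
    split; last by move: Mu0; rewrite /M mulmxDl h2 add0r.
    apply: sqnorm_eq0; rewrite sqnormE -dotp_trmx -dotp_trmx ET !mulmxA h2.
    by rewrite /dotp big1// => i _; rewrite mxE mul0r.
  case: Eu => /(rip_inj ripA D1 (leq_trans (subset_leq_card (Esupp u)) Tq)) Eu0.
  rewrite mulmxBl mul1mx Eu0 subr0 => u0.
  by move/eqP: v0; apply; rewrite -[v]trmxK -/u u0 trmx0.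
pose x := invmx M *m (E *m (A^T *m y)).
have Mx : M *m x = E *m (A^T *m y) by rewrite mulKVmx.
have xT : vsupp x \subset T.
  apply/vsuppP => j jT.
  have : (M *m x) j 0 = 0 by rewrite Mx Ee (negbTE jT) mul0r.
  have -> : M *m x = E *m (A^T *m A *m E *m x) + (x - E *m x).
    by rewrite /M mulmxDl mulmxBl mul1mx !mulmxA.
  have addE (u v : 'cV[R]_N) : (u + v) j 0 = u j 0 + v j 0 by rewrite mxE.
  have oppE (u : 'cV[R]_N) : (- u) j 0 = - u j 0 by rewrite mxE.
  by rewrite !addE oppE !Ee (negbTE jT) !mul0r subr0 add0r.
exists x; split => // j jT.
have Ex : E *m x = x.
  apply/matrixP => i l; rewrite ord1 Ee.
  have [iT|iT] := boolP (i \in T); first by rewrite mul1r.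
  by rewrite mul0r; have /vsuppP -> := xT.
rewrite dotp_col mulmxBr.
have : (M *m x) j 0 = (E *m (A^T *m y)) j 0 by rewrite Mx.
rewrite /M mulmxDl mulmxBl mul1mx -!mulmxA Ex subrr addr0 !Ee jT !mul1r => h.
have subE (u v : 'cV[R]_N) : (u - v) j 0 = u j 0 - v j 0 by rewrite !mxE.
by rewrite subE h subrr.
Qed.

Lemma sqnormD_orth y (T : {set 'I_N}) x z : normal_eq y T x -> vsupp z \subset T ->
  sqnorm (y - A *m z) = sqnorm (y - A *m x) + sqnorm (A *m (x - z)).
Proof.
move=> [xT xy] zT.
have o : dotp (A *m (x - z)) (y - A *m x) = 0.
  rewrite dotpC -dotp_trmx dotpC (dotp_supp _ (vsuppB xT zT)) big1// => j jT.
  by rewrite -dotp_col xy// mulr0.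
have -> : y - A *m z = (y - A *m x) + A *m (x - z).
  by rewrite mulmxBr addrA subrK.
move: (A *m (x - z)) (y - A *m x) o => u v o.
by rewrite !sqnormE dotpDl !dotpDr (dotpC v u) o; ring.
Qed.

Lemma normal_eq_least_squares y T x : normal_eq y T x -> is_least_squares A y T x.
Proof.
move=> xy; split; first by case: xy.
by move=> z zT; rewrite le_l2norm (sqnormD_orth xy zT) lerDl sqnorm_ge0.
Qed.

Lemma least_squares_unique y (T : {set 'I_N}) x x' : (#|T| <= q)%N -> normal_eq y T x ->
  is_least_squares A y T x' -> x' = x.
Proof.
move=> Tq xy [x'T h]; have [xT _] := xy.
have := h x xT; rewrite le_l2norm (sqnormD_orth xy x'T) gerDl => h0.
have /sqnorm_eq0 : sqnorm (A *m (x - x')) = 0.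
  by apply/eqP; rewrite eq_le h0 sqnorm_ge0.
move=> /(rip_inj ripA D1) H; apply/esym/eqP; rewrite -subr_eq0.
apply/eqP; apply: H.
by apply: leq_trans Tq; apply: subset_leq_card; exact: vsuppB.
Qed.

Lemma normal_eq_exact x0 (T : {set 'I_N}) : vsupp x0 \subset T -> normal_eq (A *m x0) T x0.
Proof.
move=> x0T; split=> // j _; rewrite subrr /dotp big1// => i _.
by rewrite [X in _ * X]mxE mulr0.
Qed.

End least_squares.

Section recovery.
Context (R : realType) (n N : nat) (A : 'M[R]_(n, N)).
Context (k : nat) (D : R).
Hypothesis ripA : rip A k.+1 D.
Hypothesis D01 : 0 <= D < 1.
Hypothesis Dk : D ^+ 2 * k%:R < (1 - D) ^+ 2.

Let D1 : D < 1. Proof. by case/andP: D01. Qed.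

(** Until the true support is covered, the residual is [A w] with [w] a nonzero
vector on the true support, so [correlation_gap] makes OMP select a new index of
that support. Its size is at most [k], hence it is covered after [k] steps, and
then the exact solution is the only least-squares solution. *)
Lemma omp_run_recovers (x0 : 'cV[R]_N) i T x r : (#|vsupp x0| <= k)%N ->
  (0 < k)%N -> omp_run A (A *m x0) k i T x r -> x k = x0.
Proof.
move=> x0k k0 [r0 T0 step].
have cardT j : (j <= k)%N -> (#|T j| <= j)%N.
  elim: j => [_|j IHj jk]; first by rewrite T0 cards0.
  have [_ -> _ _] := step j.+1 jk; rewrite -pred_Sn finset.setUC cardsU1.
  have := IHj (ltnW jk); case: (_ \notin _) => /= h.
    by rewrite add1n ltnS.
  by rewrite add0n ltnW.
have covered j : (0 < j <= k)%N -> vsupp x0 \subset T j -> x j = x0.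
  move=> jk x0T; have [_ _ ls _] := step j jk.
  have [_ jk'] := andP jk.
  apply: (least_squares_unique ripA D1 _ _ ls); last exact: normal_eq_exact.
  exact: leq_trans (cardT j jk') (leqW jk').
(* the last clause makes [w] nonzero until the true support is covered *)
have inv j : (j <= k)%N ->
   vsupp x0 \subset T j \/ [/\ T j \subset vsupp x0, #|T j| = j &
     exists w, [/\ r j = A *m w, vsupp w \subset vsupp x0,
       forall l, l \in T j -> dotp (col l A) (r j) = 0 &
       w = x0 \/ exists2 z, vsupp z \subset T j & w = x0 - z]].
  elim: j => [_|j IHj jk].
    right; rewrite T0 r0 finset.sub0set cards0; split => //.
    exists x0; split => //; first by move=> l; rewrite inE.
    by left.
  have [|[TS Tj [w [rw wS rT wx]]]] := IHj (ltnW jk).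
    move=> h; left; have [_ -> _ _] := step j.+1 jk.
    by apply: (fintype.subset_trans h); exact: finset.subsetUl.
  have [argm TE ls rE] := step j.+1 jk.
  have [h|x0T] := boolP (vsupp x0 \subset T j.+1); [by left|right].
  have w0 : w != 0.
    apply: contra x0T => /eqP w00; rewrite TE.
    apply: fintype.subset_trans (finset.subsetUl _ _).
    case: wx => [wx|[z zT wx]].
      by apply/vsuppP => l _; rewrite -wx w00 mxE.
    have -> : x0 = z by apply/eqP; rewrite -subr_eq0 -wx w00.
    by [].
  have inew : i j.+1 \in vsupp x0.
    apply: contraT => iS.
    have [l lS] := correlation_gap ripA D01 Dk x0k wS w0 iS.
    by rewrite -rw ltNge; have := argm l; rewrite -pred_Sn => ->.
  (* a selected column is orthogonal to the residual, so selecting it again would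
     make the residual orthogonal to every column *)
  have iT : i j.+1 \notin T j.
    apply/negP => ij.
    have rz := rT _ ij; have := argm; rewrite -pred_Sn => am.
    have c0 l : dotp (col l A) (r j) = 0.
      by have := am l; rewrite rz normr0 normr_le0 => /eqP.
    case/negP: (w0); apply/eqP; apply: (rip_inj ripA D1).
      by apply: leq_trans (subset_leq_card wS) (leq_trans x0k (leqnSn _)).
    apply: sqnorm_eq0; rewrite sqnormE -dotp_trmx -rw dotpC /dotp big1// => l _.
    by rewrite -dotp_col c0 mulr0.
  have TS' : T j.+1 \subset vsupp x0.
    by rewrite TE finset.subUset -pred_Sn TS/= finset.sub1set.
  split => //; first by rewrite TE -pred_Sn finset.setUC cardsU1 iT Tj.
  have Tq : (#|T j.+1| <= k.+1)%N by exact: leq_trans (cardT _ jk) (leqW jk).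
  have [xx xxn] := exists_normal_eq ripA D1 (A *m x0) Tq.
  have xE := least_squares_unique ripA D1 Tq xxn ls.
  have [xT xn] := xxn.
  exists (x0 - x j.+1); split.
  - by rewrite rE mulmxBr.
  - by apply: vsuppB => //; rewrite xE; exact: fintype.subset_trans xT TS'.
  - by move=> l lT; rewrite rE xE xn.
  - by right; exists (x j.+1) => //; rewrite xE.
apply: covered; first by rewrite k0 leqnn.
have [//|[TS Tk _]] := inv k (leqnn k).
suff -> : T k = vsupp x0 by [].
by apply/eqP; rewrite eqEcard TS Tk.
Qed.

Lemma exists_omp_run (y : 'cV[R]_n) : (0 < N)%N ->
  exists i T x r, omp_run A y k i T x r.
Proof.
move=> N0.
have j0 : 'I_N := Ordinal N0.
pose am (r : 'cV[R]_n) : 'I_N := [arg max_(i > j0) `|dotp (col i A) r|]%O.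
have amP r : is_argmax_correlation A r (am r).
  by move=> l; rewrite /am; case: arg_maxP => // i _; apply.
have lsP (T : {set 'I_N}) : {x | (#|T| <= k.+1)%N -> normal_eq A y T x}.
  apply/cid; have [Tk|Tk] := leqP #|T| k.+1; last by exists 0.
  by have [x xn] := exists_normal_eq ripA D1 y Tk; exists x.
pose ls T := sval (lsP T).
pose nxt T := am (y - A *m ls T).
pose T := fix T (j : nat) : {set 'I_N} :=
  if j is j'.+1 then (T j' :|: [set nxt (T j')])%SET else finset.set0.
have cardT j : (#|T j| <= j)%N.
  elim: j => [|j IHj]; first by rewrite cards0.
  rewrite [T _]/= finset.setUC cardsU1.
  by case: (_ \notin _) => /=; rewrite ?add1n ?add0n ?ltnS// ltnW.
exists (fun j => nxt (T j.-1)), T, (fun j => ls (T j)).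
exists (fun j => if j is _.+1 then y - A *m ls (T j) else y).
split => // -[//|j] /= jk.
have nT l : (l <= k.+1)%N -> normal_eq A y (T l) (ls (T l)).
  by move=> lk; apply: (svalP (lsP (T l))); exact: leq_trans (cardT l) lk.
split => //.
- case: j jk => [|j] jk; last exact: amP.
  (* the least-squares solution on the empty support is 0, which leaves [y] *)
  have -> : y = y - A *m ls (T 0%N).
    have -> : ls (T 0%N) = 0.
      have [/vsuppP h _] := nT 0%N isT.
      by apply/matrixP => a b; rewrite ord1 h ?mxE// inE.
    by rewrite mulmx0 subr0.
  exact: amP.
- by apply: normal_eq_least_squares; apply: (nT j.+1); exact: leqW.
Qed.

Lemma omp_recovers_of_rip : (0 < k)%N -> (0 < N)%N -> omp_recovers k A.
Proof.
move=> k0 N0 x0 x0k; apply/seteqP; split => [z [i [T [x [r [run <-]]]]]|z ->].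
  exact: omp_run_recovers run.
have [i [T [x [r run]]]] := exists_omp_run (A *m x0) N0.
by exists i, T, x, r; split => //; exact: omp_run_recovers run.
Qed.

End recovery.

(** * Counting sparse integer vectors *)

Section counting.
Context (R : realType) (N q L : nat).

(** All the integers of absolute value at most [L], each one once, as a finite
type. *)
Definition range_int (s : 'I_L.+1 + 'I_L) : int :=
  match s with inl i => Posz i | inr i => Negz i end.

Definition grid_point (f : {ffun 'I_N -> 'I_L.+1 + 'I_L}) : 'cV[int]_N :=
  \col_j range_int (f j).

Definition sparse_grid : {set {ffun 'I_N -> 'I_L.+1 + 'I_L}} :=
  [set f | (#|[set j | (grid_point f j 0 != 0)%R]%SET| <= q)%N &&
     (\sum_(j < N) grid_point f j 0 ^+ 2 <= L%:Z)]%SET.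

Lemma sparse_grid_surj (m : 'cV[int]_N) :
  (#|[set j | (m j 0 != 0)%R]%SET| <= q)%N ->
  \sum_(j < N) m j 0 ^+ 2 <= L%:Z ->
  exists2 f, f \in sparse_grid & grid_point f = m.
Proof.
move=> mq mL.
have mj j : m j 0 ^+ 2 <= L%:Z.
  apply: le_trans mL; rewrite (bigD1 j)//= lerDl.
  by apply: sumr_ge0 => i _; exact: sqr_ge0.
have ex j : {s | range_int s = m j 0}.
  have := mj j; case: (m j 0) => i iL.
    have iL1 : (i < L.+1)%N by nia.
    by exists (inl (Ordinal iL1)).
  have iL1 : (i < L)%N by nia.
  by exists (inr (Ordinal iL1)).
pose f : {ffun 'I_N -> 'I_L.+1 + 'I_L} := [ffun j => sval (ex j)].
have fm : grid_point f = m.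
  by apply/matrixP => i j; rewrite ord1 mxE ffunE; exact: (svalP (ex i)).
by exists f => //; rewrite inE fm mq mL.
Qed.

Hypothesis q0 : (0 < q)%N.
Hypothesis qN : (q <= N)%N.

Let r : R := q%:R / N%:R.

Let N0 : (0 < N)%N. Proof. exact: leq_trans qN. Qed.

Let r0 : 0 < r. Proof. by rewrite divr_gt0 ?ltr0n. Qed.

Let r1 : r <= 1. Proof. by rewrite ler_pdivrMr ?ltr0n// mul1r ler_nat. Qed.

(** With these weights, a vector of the grid has weight at least
[r^q 2^-L], while the total weight of all vectors factors over the coordinates
into at most [(1 + 2 r)^N]. The factor [r = q / N] charges nonzero entries, so
that the choice of the support is counted together with the values. *)
Definition weight (v : int) : R := if v == 0 then 1 else r * 2^-1 ^+ `|v|%N.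

Let weight_ge0 v : 0 <= weight v.
Proof.
by rewrite /weight; case: ifP => // _; rewrite mulr_ge0 ?(ltW r0)// exprn_ge0.
Qed.

Let sum_half l : \sum_(i < l) (2^-1 : R) ^+ i.+1 <= 1.
Proof.
suff -> : \sum_(i < l) (2^-1 : R) ^+ i.+1 = 1 - 2^-1 ^+ l.
  by rewrite gerBl exprn_ge0.
elim: l => [|l IHl]; first by rewrite big_ord0 expr0 subrr.
by rewrite big_ord_recr/= IHl exprS; field.
Qed.

Lemma sum_weight : \sum_s weight (range_int s) <= 1 + 2 * r.
Proof.
rewrite big_sumType/= big_ord_recl/=.
have -> : weight (Posz 0) = 1 by [].
rewrite -addrA lerD2l mulrDl mul1r; apply: lerD.
  rewrite (eq_bigr (fun i : 'I_L => r * 2^-1 ^+ i.+1)) => [|i _]; last by [].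
  by rewrite -mulr_sumr ler_piMr ?sum_half ?(ltW r0).
rewrite (eq_bigr (fun i : 'I_L => r * 2^-1 ^+ i.+1)) => [|i _]; last by [].
by rewrite -mulr_sumr ler_piMr ?sum_half ?(ltW r0).
Qed.

Lemma weight_sparse_grid f : f \in sparse_grid ->
  r ^+ q * 2^-1 ^+ L <= \prod_j weight (range_int (f j)).
Proof.
rewrite inE => /andP[fq fL].
set S := [set j | (grid_point f j 0 != 0)%R]%SET in fq.
have -> : \prod_j weight (range_int (f j)) =
   r ^+ #|S| * 2^-1 ^+ (\sum_(j < N) `|range_int (f j)|)%N.
  rewrite -prodr_const expr_sum [X in _ = X * _]big_mkcond -big_split/=; apply: eq_bigr => j _.
  rewrite /weight inE mxE; case: eqP => [->|//].
  by rewrite mul1r.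
apply: ler_pM; rewrite ?exprn_ge0 ?(ltW r0)//.
  by apply: ler_wiXn2l fq => //; exact: ltW.
apply: ler_wiXn2l; rewrite ?invr_ge0 ?invf_le1//; first by lra.
rewrite -lez_nat; apply: le_trans fL.
rewrite -[leLHS]natz natr_sum; apply: ler_sum => j _; rewrite natz mxE.
case: (range_int (f j)) => i; nia.
Qed.

(** The main term [q ln (N / q)] comes with the coefficient 1, as for the number of
supports alone: the values of the entries only contribute [exp (O (q))] when [L]
is proportional to [q]. *)
Lemma card_sparse_grid :
  #|sparse_grid|%:R <= expR (q%:R * (ln (N%:R / q%:R) + 2) + L%:R) :> R.
Proof.
have h : #|sparse_grid|%:R * (r ^+ q * 2^-1 ^+ L) <= (1 + 2 * r) ^+ N.
  apply: (@le_trans _ _ (\sum_(f : {ffun 'I_N -> 'I_L.+1 + 'I_L})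
      \prod_j weight (range_int (f j)))).
    rewrite -sum1_card natr_sum mulr_suml big_mkcond/=; apply: ler_sum => f _.
    case: ifPn => fG; first by rewrite mul1r; exact: weight_sparse_grid.
    by apply: prodr_ge0 => j _; exact: weight_ge0.
  rewrite -(bigA_distr_bigA (fun _ s => weight (range_int s)))/= prodr_const card_ord.
  apply: lerXn2r; rewrite ?nnegrE; last exact: sum_weight.
    by apply: sumr_ge0 => s _; exact: weight_ge0.
  by rewrite addr_ge0// mulr_ge0// ltW.
have rp : 0 < r ^+ q * 2^-1 ^+ L by rewrite mulr_gt0 ?exprn_gt0// invr_gt0.
rewrite -(ler_pM2r rp); apply: (le_trans h).
have -> : expR (q%:R * (ln (N%:R / q%:R) + 2) + L%:R) * (r ^+ q * 2^-1 ^+ L) =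
    expR (q%:R * 2) * (expR 1 / 2) ^+ L :> R.
  rewrite expRD mulrDr expRD (expRM_natl q (ln _)) lnK ?posrE ?divr_gt0 ?ltr0n//.
  rewrite -[L%:R]mulr1 (expRM_natl L) [in RHS]exprMn.
  have rq : (N%:R / q%:R) ^+ q * r ^+ q = 1.
    rewrite -exprMn /r (_ : _ * _ = 1) ?expr1n//; field.
    by rewrite !pnatr_eq0 -!lt0n q0 N0.
  rewrite -[RHS]mul1r -[X in _ = X * _]rq.
  move: ((N%:R / q%:R : R) ^+ q) (r ^+ q) (expR (q%:R * 2)) => x y z.
  by move: (expR 1 ^+ L) (2^-1 ^+ L) => u v; ring.
apply: (@le_trans _ _ (expR (q%:R * 2))).
  have -> : q%:R * 2 = N%:R * (2 * r) :> R.
    by rewrite /r; field; rewrite pnatr_eq0 -lt0n.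
  rewrite expRM_natl; apply: lerXn2r; rewrite ?nnegrE ?expR_ge0 ?expR_ge1Dx//.
  by rewrite addr_ge0// mulr_ge0// ltW.
rewrite ler_peMr ?expR_ge0// exprn_ege1// ler_pdivlMr// mul1r.
by have := expR_ge1Dx (1 : R); lra.
Qed.

End counting.

Section union_bound.
Context d (Omega : measurableType d) (R : realType) (P : probability Omega R).

Lemma measure_union_le (I : Type) (s : seq I) (F : I -> set Omega) (c : \bar R) :
  (forall i, measurable (F i)) -> (forall i, P (F i) <= c)%E -> (0 <= c)%E ->
  (P (\big[setU/set0]_(i <- s) F i) <= (size s)%:R%:E * c)%E.
Proof.
move=> mF Fc c0; elim: s => [|i s IHs]; first by rewrite big_nil measure0 mul0e.
rewrite big_cons (le_trans (measureU2 _ _ _))//.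
  by apply: bigsetU_measurable.
rewrite /= -natr1 EFinD ge0_muleDl ?lee_fin// mul1e addeC.
exact: leeD.
Qed.

End union_bound.

(** * Probability of recovery *)

Section rip_probability.
Context d (Omega : measurableType d) (R : realType) (P : probability Omega R).
Context (n N : nat) (a : 'I_n * 'I_N -> {RV P >-> R}).
Hypothesis ha : iid_gaussian_entries a.
Hypothesis n0 : (0 < n)%N.

(** The union bound: two tail events for each nonzero vector of the grid. *)
Lemma grid_rip_probability (q b : nat) (dl : R) : (0 < q <= N)%N -> 0 < dl <= 2 / 27 ->
  exists E : set Omega, [/\ measurable E,
    E `<=` [set w | grid_rip (random_matrix a w) q b dl] &
    ((1 - 2 * expR (q%:R * (ln (N%:R / q%:R) + 2 + b%:R ^+ 2) -
       23 / 100 * n%:R * dl ^+ 2))%:E <= P E)%E].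
Proof.
move=> /andP[q0 qN] /andP[dl0 dl1].
pose G := sparse_grid N q (q * b ^ 2).
pose v (f : {ffun 'I_N -> 'I_(q * b ^ 2).+1 + 'I_(q * b ^ 2)}) : 'cV[R]_N :=
  map_mx (fun x : int => x%:~R) (grid_point f).
(* the two tail events, for [x = dl] and [x = - dl] *)
pose T (x : R) f : set Omega :=
  [set w | x * sqnorm (random_matrix a w *m v f) <= x * (1 - x) * sqnorm (v f)].
have mT x f : measurable (T x f).
  rewrite /T -[X in measurable X]setTI.
  apply: measurable_fun_le => //; apply: measurable_funM => //.
  exact: measurable_sqnorm.
pose F f := if 0 < sqnorm (v f) then T dl f `|` T (- dl) f else set0.
have mF f : measurable (F f) by rewrite /F; case: ifP => // _; exact: measurableU.
pose c : R := 2 * expR (- (23 / 100) * n%:R * dl ^+ 2).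
have c0 : 0 <= c by rewrite mulr_ge0// expR_ge0.
have Fc f : (P (F f) <= c%:E)%E.
  rewrite /F; case: ifPn => [v0|_]; last by rewrite measure0 lee_fin.
  apply: (le_trans (measureU2 _ (mT _ _) (mT _ _))).
  rewrite /c mulr2n mulrDl mul1r EFinD; apply: leeD.
    by apply: sqnorm_tail => //; lra.
  by rewrite -sqrrN; apply: sqnorm_tail => //; lra.
pose U := \big[setU/set0]_(f <- enum G) F f.
have mU : measurable U by apply: bigsetU_measurable.
have PU : (P U <= ((size (enum G))%:R * c)%:E)%E.
  by rewrite EFinM; apply: measure_union_le => //; rewrite lee_fin.
exists (~` U); split; first exact: measurableC.
- move=> w /= Uw m mq mL.
  have [f fG fm] := sparse_grid_surj mq mL.
  have wF : ~ F f w.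
    move=> wF; apply: Uw; rewrite /U -bigcup_seq; exists f => //=.
    by rewrite mem_enum.
  rewrite /= (_ : map_mx _ _ = v f); last by rewrite /v fm.
  have [v0|v0] := ltP 0 (sqnorm (v f)); last first.
    have /sqnorm_eq0 -> : sqnorm (v f) = 0.
      by apply/eqP; rewrite eq_le v0 sqnorm_ge0.
    by rewrite mulmx0 !sqnorm0 subrr normr0 mulr0.
  move: wF; rewrite /F v0 => /not_orP[/negP + /negP].
  rewrite -!ltNge => h1 h2.
  rewrite -mulrA ltr_pM2l// in h1.
  rewrite -mulrA ltr_nM2l ?oppr_lt0// in h2.
  by rewrite ler_norml; apply/andP; split; lra.
- rewrite probability_setC//.
  have PUf : P U = (fine (P U))%:E by rewrite fineK// fin_num_measure.
  rewrite PUf -EFinB lee_fin lerD2l lerN2 -lee_fin -PUf.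
  apply: (le_trans PU); rewrite lee_fin /c mulrCA ler_pM2l//.
  rewrite (_ : _ - _ = q%:R * (ln (N%:R / q%:R) + 2) + (q * b ^ 2)%:R +
    - (23 / 100) * n%:R * dl ^+ 2); last by rewrite natrM natrX; ring.
  rewrite expRD ler_wpM2r ?expR_ge0// -cardE.
  exact: card_sparse_grid.
Qed.

End rip_probability.

Section parameters.
Context (R : realType).

(** Here [K] is the sparsity used in place of [k]: it must be large for the Chernoff
bound to be nearly sharp and for [D (1 + sqrt K) < 1] to follow from
[D sqrt K = 95/98]. With a net of mesh [1/100] and [dl^2 = 0.9025 / K], the
exponent [0.23 n dl^2] of the tail is at least [1.1 K x], which beats the
exponent [(K + 1) (x + 10002)] of the cardinality of the grid. *)
Lemma omp_probability d (Omega : measurableType d) (P : probability Omega R)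
    (n N k K : nat) (a : 'I_n * 'I_N -> {RV P >-> R}) (x := ln (N%:R / K%:R) : R) :
  iid_gaussian_entries a -> (0 < k <= K)%N -> (n <= N)%N ->
  1600 <= K%:R :> R -> 10 ^+ 7 <= x ->
  11 / 2 * K%:R ^+ 2 * x <= n%:R ->
  exists E : set Omega, [/\ measurable E,
    E `<=` [set w | omp_recovers k (random_matrix a w)] &
    ((1 - 2 * expR (- x))%:E <= P E)%E].
Proof.
move=> ha /andP[k0 kK] nN K1600 x7 nK.
have K0 : 0 < K%:R :> R by lra.
have K2 : K%:R + 1 <= n%:R :> R.
  apply: le_trans nK.
  have : 10 ^+ 7 * K%:R <= x * K%:R by rewrite ler_wpM2r// ltW.
  nra.
have KnN : (K < n)%N by rewrite -(ltr_nat R); lra.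
have n0 : (0 < n)%N by exact: leq_ltn_trans KnN.
have KN : (0 < K.+1 <= N)%N by rewrite /= (leq_trans KnN).
pose s : R := Num.sqrt K%:R.
have s0 : 0 < s by rewrite sqrtr_gt0.
have s2 : s ^+ 2 = K%:R by rewrite sqr_sqrtr// ltW.
have s40 : 40 <= s.
  by rewrite -ler_sqr ?nnegrE ?(ltW s0)// s2; apply: le_trans K1600; lra.
pose dl := 19 / 20 / s.
have dl0 : 0 < dl by rewrite divr_gt0.
have dl1 : dl <= 19 / 800.
  by rewrite /dl ler_pdivrMr//; lra.
have dl2 : dl ^+ 2 = 361 / 400 / K%:R by rewrite /dl expr_div_n s2; congr (_ / _); field.
have [|E [mE EG PE]] := @grid_rip_probability _ _ _ _ _ _ a ha n0 K.+1 100 dl KN.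
  by rewrite dl0/=; lra.
exists E; split => //.
- move=> w /EG /= grid.
  have ripA : rip (random_matrix a w) K.+1 (dl / (1 - 2 / 100)).
    by apply: rip_of_grid => //; exact: ltW.
  pose D := dl / (1 - 2 / 100).
  have D0 : 0 <= D by rewrite divr_ge0//; [exact: ltW|lra].
  have DE : D = 50 / 49 * dl by rewrite /D; field.
  have Ds : D ^+ 2 * K%:R = (95 / 98) ^+ 2.
    by rewrite DE exprMn dl2; field; rewrite gt_eqF.
  have D1 : D <= 1 / 40 by rewrite DE; lra.
  apply: (@omp_recovers_of_rip _ _ _ _ _ D); last 2 first.
  + exact: k0.
  + by apply: leq_trans nN.
  + by move=> u uk; apply: ripA; apply: leq_trans uk _; rewrite ltnS.
  + by rewrite D0/=; lra.
  + apply: (@le_lt_trans _ _ (D ^+ 2 * K%:R)).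
      by rewrite ler_wpM2l ?sqr_ge0// ler_nat.
    by rewrite Ds; nra.
- apply: le_trans PE; rewrite lee_fin lerD2l lerN2 ler_pM2l// ler_expR.
  have h1 : ln (N%:R / K.+1%:R) <= x.
    have N0 : 0 < N%:R :> R by rewrite ltr0n (leq_trans n0).
    have K0' : 0 < K.+1%:R :> R by rewrite ltr0n.
    rewrite /x ler_ln ?posrE ?(divr_gt0 N0)// ler_pM2l// lef_pV2 ?posrE//.
    by rewrite ler_nat.
  have h2 : 11 / 10 * K%:R * x <= 23 / 100 * n%:R * dl ^+ 2.
    rewrite dl2 [leRHS](_ : _ = 23 / 100 * (361 / 400) * n%:R / K%:R); last first.
      by field; rewrite gt_eqF.
    rewrite ler_pdivlMr//; nra.
  have h3 : K.+1%:R * (ln (N%:R / K.+1%:R) + 2 + 100%:R ^+ 2) <=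
      (K%:R + 1) * (101 / 100 * x) :> R.
    have -> : K%:R + 1 = K.+1%:R :> R by rewrite natr1.
    by apply: ler_wpM2l => //; lra.
  nra.
Qed.

(** With [x = ln (N / k)], the bracket of the hypothesis is
[3 x + 3 - ln (N / n)], and [N / n] stays bounded: for large [k] the right-hand
side is close to [6 k^2 x]. Since the bracket is also at least 3, [k] is at most
[sqrt n], which makes [x] large. When [k <= K0], [K] is the constant [K0] and the
claims only say that [n] is large compared to 1 and to [ln N]. *)
Lemma omp_regime (k n N K0 : nat) (C X : R) (K := maxn k K0) :
  1600 <= K0%:R :> R ->
  (0 < k <= n)%N -> (n <= N)%N -> 1 <= C -> 0 <= X -> N%:R <= C * n%:R ->
  n%:R > 2 * k%:R * (k%:R - 1) * (3 + 2 * ln N%:R + ln n%:R - 3 * ln k%:R) :> R ->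
  2 * (X + 5 * ln C + ln K0%:R) <= ln n%:R ->
  (11 * K0%:R ^+ 2) ^+ 2 * C <= n%:R ->
  X <= ln (N%:R / K%:R) /\ 11 / 2 * K%:R ^+ 2 * ln (N%:R / K%:R) <= n%:R :> R.
Proof.
move=> K1600 /andP[k0 kn] nN C1 X0 NC cond nX nC.
have lnC : 0 <= ln C by rewrite ln_ge0.
have k0' : 0 < k%:R :> R by rewrite ltr0n.
have n0 : 0 < n%:R :> R by rewrite ltr0n (leq_trans k0).
have N0 : 0 < N%:R :> R by rewrite ltr0n (leq_trans k0)// (leq_trans kn).
have lnN : ln n%:R <= ln N%:R :> R by rewrite ler_ln ?posrE// ler_nat.
have lnk : ln k%:R <= ln n%:R :> R by rewrite ler_ln ?posrE// ler_nat.
have lnNC : ln N%:R <= ln C + ln n%:R.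
  rewrite -lnM ?posrE//; last exact: lt_le_trans C1.
  by rewrite ler_ln ?posrE// mulr_gt0//; exact: lt_le_trans C1.
have lK0 : 0 <= ln K0%:R :> R by rewrite ln_ge0//; lra.
have K00 : 0 < K0%:R :> R by lra.
have [kK|kK] := leqP k K0.
  have -> : K%:R = K0%:R :> R by rewrite /K (maxn_idPr kK).
  rewrite ln_div ?posrE//; split; first by lra.
  (* [ln N <= 2 sqrt (C n)] by [ln y < y] at [y = sqrt (C n)] *)
  pose y : R := Num.sqrt (C * n%:R).
  have Cn0 : 0 < C * n%:R by rewrite mulr_gt0//; exact: lt_le_trans C1.
  have y2 : y ^+ 2 = C * n%:R by rewrite sqr_sqrtr// ltW.
  have y0 : 0 < y by rewrite sqrtr_gt0.
  have lny : ln N%:R <= 2 * y.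
    have -> : 2 * y = y *+ 2 by rewrite mulr_natl.
    apply: (@le_trans _ _ (ln (y ^+ 2))).
      by rewrite ler_ln ?posrE ?exprn_gt0// y2.
    rewrite lnXn// lerMn2r/=; exact: ltW (ln_sublinear y0).
  have hy : 11 * K0%:R ^+ 2 * y <= n%:R.
    have K2 : 0 <= 11 * K0%:R ^+ 2 :> R by rewrite mulr_ge0// exprn_ge0// ltW.
    rewrite -ler_sqr ?nnegrE ?(mulr_ge0 K2) ?(ltW y0) ?(ltW n0)// exprMn y2 mulrA expr2.
    by rewrite ler_pM2r.
  have : K0%:R ^+ 2 * (ln N%:R - ln K0%:R) <= K0%:R ^+ 2 * (2 * y).
    by rewrite ler_wpM2l ?exprn_ge0 ?(ltW K00)//; lra.
  by lra.
have -> : K%:R = k%:R :> R by rewrite /K (maxn_idPl (ltnW kK)).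
have k16 : 1600 <= k%:R :> R by apply: (le_trans K1600); rewrite ler_nat ltnW.
have kk : 6 * k%:R * (k%:R - 1) <= n%:R :> R.
  apply: le_trans (ltW cond).
  have -> : 6 * k%:R * (k%:R - 1) = 2 * k%:R * (k%:R - 1) * 3 :> R by ring.
  by rewrite ler_wpM2l//; [rewrite !mulr_ge0//; lra|lra].
have k2n : 2 * ln k%:R <= ln n%:R :> R.
  have -> : 2 * ln k%:R = ln (k%:R ^+ 2) :> R by rewrite lnXn// mulr_natl.
  rewrite ler_ln ?posrE ?exprn_gt0//; nra.
rewrite ln_div ?posrE//; set x := ln N%:R - ln k%:R.
have xX : X + 5 * ln C <= x by rewrite /x; lra.
split; first by lra.
apply: le_trans (ltW cond).
have h : 3 * x - ln C <= 3 + 2 * ln N%:R + ln n%:R - 3 * ln k%:R.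
  by rewrite /x; lra.
apply: (@le_trans _ _ (2 * k%:R * (k%:R - 1) * (3 * x - ln C))); last first.
  by rewrite ler_wpM2l// !mulr_ge0//; lra.
have -> : 11 / 2 * k%:R ^+ 2 * x = k%:R * (11 / 2 * k%:R * x) by ring.
have -> : 2 * k%:R * (k%:R - 1) * (3 * x - ln C) =
    k%:R * (2 * (k%:R - 1) * (3 * x - ln C)) by ring.
rewrite ler_pM2l//.
have hx : 14 / 5 * x <= 3 * x - ln C by lra.
apply: (@le_trans _ _ (2 * (k%:R - 1) * (14 / 5 * x))).
  nra.
by rewrite ler_pM2l//; lra.
Qed.

End parameters.

(** * Asymptotics *)

Theorem corollary7 (R : realType) (delta : R) (k n N : nat -> nat)
  (hdelta : 0 < delta < 1)
  (hk : forall m, (0 < k m)%N)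
  (hkn : forall m, (k m <= n m)%N)
  (hnN : forall m, (n m <= N m)%N)
  (hn : n m @[m --> \oo] --> \oo)
  (hnNdelta : ((n m)%:R / (N m)%:R : R) @[m --> \oo] --> delta)
  (hcond : forall m,
     (n m)%:R > 2 * (k m)%:R * ((k m)%:R - 1) *
       (3 + 2 * ln (N m)%:R + ln (n m)%:R - 3 * ln (k m)%:R) :> R)
  (d : nat -> measure_display) (Omega : forall m, measurableType (d m))
  (P : forall m, probability (Omega m) R)
  (a : forall m, 'I_(n m) * 'I_(N m) -> {RV (P m) >-> R})
  (ha : forall m, iid_gaussian_entries (a m)) :
  with_probability_tending_to_1 P
    (fun m w => omp_recovers (k m) (random_matrix (a m) w)).
Proof.
case/andP: hdelta => delta0 delta1.
pose K0 := (40 ^ 2)%N.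
have K01600 : 1600 <= K0%:R :> R.
  by rewrite /K0 natrX; lra.
pose K m := maxn (k m) K0.
pose x m : R := ln ((N m)%:R / (K m)%:R).
pose good m := 10 ^+ 7 <= x m /\ 11 / 2 * (K m)%:R ^+ 2 * x m <= (n m)%:R.
(* only the eventually good [m] matter; elsewhere the empty event will do *)
have ex m : exists E : set (Omega m), [/\ measurable E,
    E `<=` [set w | omp_recovers (k m) (random_matrix (a m) w)] &
    good m -> ((1 - 2 * expR (- x m))%:E <= P m E)%E].
  have [[x7 nK]|bad] := pselect (good m).
    have kK : (0 < k m <= K m)%N by rewrite hk leq_maxl.
    have K1600 : 1600 <= (K m)%:R :> R by apply: (le_trans K01600); rewrite ler_nat leq_maxr.
    have [E [mE EG PE]] := omp_probability (ha m) kK (hnN m) K1600 x7 nK.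
    by exists E.
  by exists set0; split => //; exact: sub0set.
pose E m := sval (cid (ex m)).
have EP m := svalP (cid (ex m)).
exists E; split; [by move=> m; case: (EP m)|by move=> m; case: (EP m)|].
pose C : R := 2 / delta.
have C1 : 1 <= C by rewrite /C ler_pdivlMr//; lra.
have nearN : \forall m \near \oo, (N m)%:R <= C * (n m)%:R.
  have : \forall m \near \oo, delta / 2 < (n m)%:R / (N m)%:R.
    by apply: (cvgr_gt delta) => //; lra.
  apply: filterS => m; have N0 : 0 < (N m)%:R :> R.
    by rewrite ltr0n (leq_trans (hk m))// (leq_trans (hkn m)).
  rewrite ltr_pdivlMr// => h.
  by rewrite /C mulrAC ler_pdivlMr//; lra.
have nearn (B : R) : \forall m \near \oo, B <= (n m)%:R.
  near=> m.
  have h : (Num.truncn B < n m)%N by near: m; exact: ((cvgnyPge _).1 hn).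
  by apply: ltW; apply: (lt_le_trans (truncnS_gt B)); rewrite ler_nat.
have regime (X : R) : 0 <= X -> \forall m \near \oo, X <= x m /\
    11 / 2 * (K m)%:R ^+ 2 * x m <= (n m)%:R.
  move=> X0; near=> m.
  have nB : expR (2 * (X + 5 * ln C + ln K0%:R)) <= (n m)%:R by near: m; exact: nearn.
  apply: (omp_regime K01600 _ (hnN m) C1 X0 _ (hcond m)).
  - by rewrite hk hkn.
  - by near: m; exact: nearN.
  - by rewrite -ler_expR lnK// posrE (lt_le_trans _ nB)// expR_gt0.
  - by near: m; exact: nearn.
have finE m : P m (E m) = (fine (P m (E m)))%:E.
  by rewrite fineK// fin_num_measure//; case: (EP m).
under eq_fun do rewrite finE.
apply: cvg_EFin; first by near=> m; rewrite -finE fin_num_measure//; case: (EP m).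
apply/cvgrPdist_le => e e0.
pose X := Num.max (10 ^+ 7) (- ln (e / 2)).
near=> m.
have [Xx nK] : X <= x m /\ 11 / 2 * (K m)%:R ^+ 2 * x m <= (n m)%:R.
  near: m; apply: regime; rewrite /X le_max exprn_ge0//.
have [mE _ PE] := EP m.
have /PE : good m by split => //; apply: le_trans Xx; rewrite /X le_max lexx.
rewrite -/(E m) finE lee_fin /= => h.
have h1 : fine (P m (E m)) <= 1 by rewrite -lee_fin -finE probability_le1.
rewrite ger0_norm ?subr_ge0//.
have : expR (- x m) <= e / 2.
  rewrite -[leRHS]lnK ?posrE ?divr_gt0// ler_expR lerNl; apply: le_trans Xx.
  by rewrite /X le_max lexx orbT.
lra.
Unshelve. all: by end_near.
Qed.
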